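(* Let $(G,S)$ be a Cayley graph of a group of polynomial growth with homogeneous dimension $N\geq3$, and let $1<p<\frac N2$. Then $D_0^{2,p}(G)=D^{2,p}(G)$.
   Context: $G$ is a finitely generated group and $S$ a finite generating set with $S=S^{-1}$. The Cayley graph $(G,S)$ has vertex set $G$, and $x\sim y$ iff $x=ys$ for some $s\in S$. $\beta_S(n)$ is the number of elements of $G$ at word distance at most $n$ from the unit element. $G$ is of polynomial growth with homogeneous dimension $N\in\mathbb N$ if there are constants $C_1,C_2>0$ depending on $S$ with $C_1n^N\le\beta_S(n)\le C_2n^N$ for all $n\ge1$. For $u:G\to\mathbb R$, $\Delta u(x):=\sum_{y\sim x}(u(y)-u(x))$ and $\lVert u\rVert_{D^{2,p}(G)}:=\lVert\Delta u\rVert_{\ell^p(G)}$. $D_0^{2,p}(G)$ is the completion of the finitely supported functions in this norm, its elements being regarded as functions on $G$ (a Cauchy sequence of finitely supported functions is identified with its pointwise limit), and $D^{2,p}(G):=\{u\in\ell^{\frac{Np}{N-2p}}(G):\lVert u\rVert_{D^{2,p}(G)}<\infty\}$. *)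

(* Defs.v *)
From mathcomp Require Export all_boot all_order all_algebra.
From mathcomp Require Export finmap.
From mathcomp Require Export all_classical all_reals all_analysis.

Set Implicit Arguments.
Unset Strict Implicit.
Unset Printing Implicit Defensive.

Export Order.TTheory GRing.Theory Num.Theory.
Export numFieldNormedType.Exports.

Local Open Scope classical_set_scope.
Local Open Scope ring_scope.

(* Here G is a possibly infinite group (groupType), not a finGroupType. *)

Definition is_subgroup (G : groupType) (H : set G) : Prop :=
  [/\ H 1%g, (forall x y, H x -> H y -> H (x * y)%g)
    & (forall x, H x -> H x^-1%g)].

Definition generates (G : groupType) (S : set G) : Prop :=
  smallest [set H | is_subgroup H] S = [set: G].

Definition symmetric_set (G : groupType) (S : set G) : Prop :=
  [set x^-1%g | x in S] = S.

Definition adjacent (G : groupType) (S : set G) (x y : G) : Prop :=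
  exists2 s, S s & x = (y * s)%g.

Definition joined_by_word (G : groupType) (S : set G) (x y : G) (n : nat)
    : Prop :=
  exists w : n.-tuple G,
    (forall i, S (tnth w i)) /\ y = (x * \prod_(i < n) tnth w i)%g.

(* The minimum exists whenever S is symmetric and generates G; otherwise
   [get] may return a junk value. *)
Definition word_distance (G : groupType) (S : set G) (x y : G) : nat :=
  get [set n | joined_by_word S x y n /\
               forall m, joined_by_word S x y m -> (n <= m)%N].

Definition word_ball (G : groupType) (S : set G) (n : nat) : set G :=
  [set x | (word_distance S 1%g x <= n)%N].

(* [fset_set] is meaningful here because the balls are finite when S is a
   finite symmetric generating set. *)
Definition growth (G : groupType) (S : set G) (n : nat) : nat :=
  #|` fset_set (word_ball S n)|.

Definition polynomial_growth (R : realType) (G : groupType) (S : set G)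
    (N : nat) : Prop :=
  exists C1 C2 : R, [/\ 0 < C1, 0 < C2 &
    forall n : nat, (1 <= n)%N ->
      C1 * n%:R ^+ N <= (growth S n)%:R <= C2 * n%:R ^+ N].

(* A sum over the set of neighbours, hence without multiplicities. *)
Definition laplacian (R : realType) (G : groupType) (S : set G) (u : G -> R)
    (x : G) : R :=
  \sum_(y \in [set y | adjacent S y x]) (u y - u x).

Definition lp_norm (R : realType) (T : choiceType) (p : R) (u : T -> R)
    : \bar R :=
  ((\esum_(x in [set: T]) (`|u x| `^ p)%:E) `^ p^-1)%E.

Definition lp_space (R : realType) (T : choiceType) (p : R) : set (T -> R) :=
  [set u | (lp_norm p u < +oo)%E].

Definition D2p_norm (R : realType) (G : groupType) (S : set G) (p : R)
    (u : G -> R) : \bar R :=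
  lp_norm p (laplacian S u).

Definition finitely_supported (R : realType) (T : choiceType) (u : T -> R)
    : Prop :=
  finite_set [set x | u x != 0].

Definition D2p_cauchy (R : realType) (G : groupType) (S : set G) (p : R)
    (phi : nat -> G -> R) : Prop :=
  forall e : R, 0 < e -> exists K : nat, forall m n : nat,
    (K <= m)%N -> (K <= n)%N -> (D2p_norm S p (phi m \- phi n)%R < e%:E)%E.

(* The completion of the finitely supported functions, an element of which
   (the class of a Cauchy sequence) is identified with the pointwise limit. *)
Definition D2p0_space (R : realType) (G : groupType) (S : set G) (p : R)
    : set (G -> R) :=
  [set u | exists phi : nat -> G -> R,
    [/\ forall k, finitely_supported (phi k),
        D2p_cauchy S p phi
      & forall x, phi k x @[k --> \oo] --> u x]].

Definition D2p_space (R : realType) (G : groupType) (S : set G) (N : nat)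
    (p : R) : set (G -> R) :=
  [set u | lp_space (N%:R * p / (N%:R - 2 * p)) u /\
           (D2p_norm S p u < +oo)%E].

(* Main.v *)
Require Import Defs.
From mathcomp Require Import ring lra.

Set Implicit Arguments.
Unset Strict Implicit.
Unset Printing Implicit Defensive.

Local Open Scope classical_set_scope.
Local Open Scope ring_scope.

(** Write d for the number of generators and q = N p / (N - 2 p). Both
    inclusions follow from one a priori estimate, the second-order Sobolev
    inequality: if u tends to 0 at infinity, then the q-norm of u is at most a
    constant times the p-norm of its Laplacian ([sobolev_vanishing]).

    It comes straight from isoperimetry, without heat kernel or Green function
    bounds. Averaging the indicator of a finite set A over the translations by
    a ball twice as large as A gives
    #|A|^(1 - 1/N) <= K * (boundary of A) ([isoperimetric_inequality]), and the
    layer-cake decomposition turns this into an inequality for the l^1 norm of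
    the gradient ([gradient_sobolev]). Let now v >= 0 be finitely supported
    with -Delta v <= h. Apply the l^1 inequality to v^alpha, where
    alpha = q (1 - 1/N), and split each gradient term by Cauchy-Schwarz as
      |a^alpha - b^alpha|^2 <= M (a - b) (a^gamma - b^gamma) (a^q + b^q),
    where gamma = q (1 - 1/p). The factors (a - b) (a^gamma - b^gamma) add up
    to twice the pairing of -Delta v with v^gamma, hence to at most twice the
    sum of h v^gamma, which Hoelder bounds by the p-norm of h times a power of
    the q-norm of v. The exponents match exactly at q; p > 1 is what makes
    gamma positive. Since all this is homogeneous, it is enough to do it when
    the q-norm of v is 1, where Young's inequality with a small weight replaces
    both Cauchy-Schwarz and Hoelder ([sobolev_normalized]). For signed u
    tending to 0 at infinity, the truncation (|u| - e)^+ is finitely supported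
    and satisfies -Delta (|u| - e)^+ <= |Delta u| everywhere, so that a small
    e gives the general case.

    A limit u of a Cauchy sequence of finitely supported functions is then in
    l^q with Laplacian in l^p, by Fatou's lemma. Conversely let u be in l^q
    with f = Delta u in l^p. The Laplacians of finitely supported functions are
    dense in l^p ([density]), so that f is the limit of Delta phi_k, and the
    Sobolev inequality for u - phi_k gives phi_k -> u. For the density, let P
    be the averaging operator of the simple random walk and f finitely
    supported: f minus its Cesaro mean (1/n) sum_(k < n) P^k f is the Laplacian
    of an explicit finitely supported function, and the Cesaro mean tends to 0
    in l^p, since it has bounded l^1 norm while its supremum is O(1/n) by the
    Sobolev inequality for sum_(k < n) P^k |f|. *)

(** * Sums of nonnegative functions *)

(** Extended-real valued, so that comparison, additivity and translation
    invariance hold for all nonnegative functions without any finiteness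
    condition. *)
Definition total (R : realType) (T : choiceType) (u : T -> R) : \bar R :=
  \esum_(x in [set: T]) (u x)%:E.

Section Total.
Variables (R : realType) (T : choiceType).
Implicit Types (u v : T -> R).

Lemma total_ge0 u : (forall x, 0 <= u x) -> (0 <= total u)%E.
Proof. by move=> u0; apply: esum_ge0 => x _; rewrite lee_fin. Qed.

Lemma le_total u v : (forall x, u x <= v x) -> (total u <= total v)%E.
Proof. by move=> uv; apply: le_esum => x _; rewrite lee_fin. Qed.

Lemma eq_total u v : u =1 v -> total u = total v.
Proof. by move=> uv; apply: eq_esum => x _; rewrite uv. Qed.

Lemma total0 : total (fun _ : T => 0 : R) = 0%E.
Proof. by apply: esum1. Qed.

Lemma totalD u v : (forall x, 0 <= u x) -> (forall x, 0 <= v x) ->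
  total (fun x => u x + v x) = (total u + total v)%E.
Proof.
move=> u0 v0; rewrite -esumD => [|x _|x _]; rewrite ?lee_fin//.
Qed.

Lemma total_sum (I : choiceType) (r : seq I) (u : I -> T -> R) :
    (forall i x, 0 <= u i x) ->
  total (fun x => \sum_(i <- r) u i x) = (\sum_(i <- r) total (u i))%E.
Proof.
move=> u0; rewrite -esum_sum => [|x i _ _]; last by rewrite lee_fin.
by apply: eq_esum => x _; rewrite sumEFin.
Qed.

Lemma sum_le_total u (F : {fset T}) : (forall x, 0 <= u x) ->
  ((\sum_(x <- F) u x)%:E <= total u)%E.
Proof.
move=> u0; apply: esum_ge; exists [set` F] => //.
by rewrite fsbig_finite//= set_fsetK sumEFin.
Qed.

Lemma total_lub u (B : \bar R) :
    (forall F : {fset T}, ((\sum_(x <- F) u x)%:E <= B)%E) ->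
  (total u <= B)%E.
Proof.
move=> uB; apply: ge_ereal_sup => _ [F [finF _] <-].
by rewrite fsbig_finite//= sumEFin.
Qed.

Lemma le_total1 u x : (forall x, 0 <= u x) -> ((u x)%:E <= total u)%E.
Proof.
by move=> u0; have := sum_le_total [fset x]%fset u0; rewrite big_seq_fset1.
Qed.

Lemma totalZ (c : R) u : 0 <= c -> (forall x, 0 <= u x) ->
  total (fun x => c * u x) = (c%:E * total u)%E.
Proof.
move=> c0 u0; have [->|cn0] := eqVneq c 0.
  by rewrite mul0e -[RHS]total0; apply: eq_total => x; rewrite mul0r.
have {}c0 : 0 < c by rewrite lt_def cn0.
have H d v : 0 < d -> (forall x, 0 <= v x) ->
    (total (fun x => d * v x)%R <= d%:E * total v)%E.
  move=> d0 v0; apply: total_lub => F.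
  by rewrite -mulr_sumr EFinM lee_pmul2l// sum_le_total.
apply/eqP; rewrite eq_le H//=.
have ci0 : 0 < c^-1 by rewrite invr_gt0.
have := H c^-1 (fun x => c * u x) ci0 (fun x => mulr_ge0 (ltW c0) (u0 x)).
under [X in (total X <= _)%E -> _]funext do rewrite mulKf ?gt_eqF//.
by rewrite -(@lee_pmul2l _ c%:E)// muleA -EFinM divff ?gt_eqF// mul1e.
Qed.

Lemma total_supp u (F : {fset T}) : (forall x, 0 <= u x) ->
    (forall x, x \notin F -> u x = 0) ->
  total u = (\sum_(x <- F) u x)%:E.
Proof.
move=> u0 uF; apply/eqP; rewrite eq_le sum_le_total// andbT.
apply: total_lub => E; rewrite lee_fin (big_fsetID _ (mem F))/=.
rewrite [X in _ + X]big_seq_cond [X in _ + X]big1 ?addr0; last first.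
  by move=> x /andP[]; rewrite !inE => /andP[_ /uF].
rewrite [leRHS](big_fsetID _ (mem E))/=.
rewrite (_ : [fset x | x in E & x \in F] = [fset x | x in F & x \in E])%fset.
  by rewrite lerDl sumr_ge0.
by apply/fsetP => x; rewrite !inE andbC.
Qed.

Lemma finitely_supportedP u : finitely_supported u ->
  exists F : {fset T}, forall x, x \notin F -> u x = 0.
Proof.
move=> fu; exists (fset_set [set x | u x != 0]) => x.
rewrite in_fset_set// => /negP xF; apply/eqP; apply: contra_notT xF => ux.
by rewrite inE.
Qed.

Lemma fset_finitely_supported u (F : {fset T}) :
  (forall x, x \notin F -> u x = 0) -> finitely_supported u.
Proof.
move=> uF; apply: (@sub_finite_set _ _ [set` F]) => // x /= ux.
by apply: contraNT ux => /uF ->.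
Qed.

Lemma total_fin u : (forall x, 0 <= u x) -> finitely_supported u ->
  exists2 r : R, 0 <= r & total u = r%:E.
Proof.
move=> u0 /finitely_supportedP[F uF]; exists (\sum_(x <- F) u x).
  by rewrite sumr_ge0.
exact: total_supp.
Qed.

Lemma total_tail u (e : R) : (forall x, 0 <= u x) -> (total u < +oo)%E ->
    0 < e ->
  exists F : {fset T},
    (total (fun x => if x \in F then 0 else u x)%R <= e%:E)%E.
Proof.
move=> u0 uoo e0.
have ufin : total u \is a fin_num by rewrite ge0_fin_numE// total_ge0.
have : (total u - e%:E < total u)%E by rewrite lteBlDr// lteDl// lte_fin.
move=> /ereal_sup_gt[_ [A [finA _] <-]].
rewrite fsbig_finite//= sumEFin; set F := fset_set A => uF; exists F.
have uE : total u = ((\sum_(x <- F) u x)%:E +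
                     total (fun x => if x \in F then 0 else u x)%R)%E.
  rewrite (eq_big_seq (fun x => if x \in F then u x else 0)); last by move=> x ->.
  rewrite -(@total_supp (fun x => if x \in F then u x else 0)); first last.
  - by move=> x /negPf ->.
  - by move=> x; case: ifP.
  rewrite -totalD => [|x|x]; try by case: ifP.
  by apply: eq_total => x; case: ifP; rewrite ?addr0 ?add0r.
move: uF; rewrite EFinN lteBlDr// uE lteD2lE//; exact: ltW.
Qed.

Lemma total_vanish u (e : R) : (forall x, 0 <= u x) -> (total u < +oo)%E ->
    0 < e -> finite_set [set x | e < u x].
Proof.
move=> u0 uoo e0; have [F uF] := total_tail u0 uoo e0.
apply: (@sub_finite_set _ _ [set` F]) => // x /= eu.
apply: contraTT eu => xF; rewrite -leNgt -lee_fin; apply: le_trans uF.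
pose v x := if x \in F then 0 else u x.
have := @le_total1 v x; rewrite /v (negPf xF); apply => y.
by case: ifP.
Qed.

End Total.

Lemma total_bij (R : realType) (T : choiceType) (u : T -> R) (h : T -> T) :
  bijective h -> total (fun x => u (h x)) = total u.
Proof.
move=> [g hK gK]; symmetry; apply: (reindex_esum [set: T] [set: T] h).
split=> // [x y _ _ /(can_inj hK)//|y _].
by exists (g y).
Qed.

(** * Inequalities for real powers *)

Section PowR.
Variable R : realType.
Implicit Types (a b x y al ga p : R).

Lemma ler_powR2 a b al : 0 <= al -> 0 <= a -> a <= b -> a `^ al <= b `^ al.
Proof.
move=> al0 a0 ab; apply: ge0_ler_powR => //; rewrite nnegrE//.
exact: le_trans ab.
Qed.

Lemma powRD_ge0 a x y : 0 <= a -> 0 < x -> 0 < y ->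
  a `^ (x + y) = a `^ x * a `^ y.
Proof. by move=> a0 x0 y0; rewrite powRD// gt_eqF// addr_gt0. Qed.

Lemma powRVK a al : 0 <= a -> al != 0 -> (a `^ al^-1) `^ al = a.
Proof. by move=> a0 al0; rewrite -powRrM mulVf// powRr1. Qed.

Lemma powRKV a al : 0 <= a -> al != 0 -> (a `^ al) `^ al^-1 = a.
Proof. by move=> a0 al0; rewrite -powRrM mulfV// powRr1. Qed.

Lemma powR_normD_le a b p : 0 <= p ->
  `|a + b| `^ p <= 2 `^ p * (`|a| `^ p + `|b| `^ p).
Proof.
move=> p0; wlog ab : a b / `|a| <= `|b|.
  by move=> H; have [/H//|/ltW/H] := leP `|a| `|b|; rewrite addrC [X in _ * X]addrC.
rewrite (@le_trans _ _ ((2 * `|b|) `^ p))//.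
  by apply: ler_powR2 => //; rewrite (le_trans (ler_normD _ _))// mulrDl mul1r lerD2r.
by rewrite powRM// ler_wpM2l ?powR_ge0// lerDr powR_ge0.
Qed.

(** Young's inequality in the form saying that the graph of the power function
    lies above its tangent at [a]. *)
Lemma powR_tangent a b al : 1 < al -> 0 <= a -> 0 <= b ->
  al * a `^ (al - 1) * b <= (al - 1) * a `^ al + b `^ al.
Proof.
move=> al1 a0 b0; have al0 : 0 < al by lra.
have alB : 0 < al - 1 by lra.
pose be := al / (al - 1).
have be0 : 0 < be by rewrite divr_gt0.
have := @conjugate_powR R (a `^ (al - 1)) b be al (powR_ge0 _ _) b0 be0 al0.
rewrite -powRrM /be mulrCA divff ?gt_eqF// mulr1 => H.
have {}H : a `^ (al - 1) * b <= a `^ al / (al / (al - 1)) + b `^ al / al.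
  by apply: H; field; rewrite !gt_eqF.
rewrite -mulrA -ler_pdivlMl//; apply: le_trans H _; rewrite le_eqVlt.
by apply/orP; left; apply/eqP; field; rewrite !gt_eqF.
Qed.

Lemma powR_sub_le a b al : 1 < al -> 0 <= a -> 0 <= b ->
  a `^ al - b `^ al <= al * (a - b) * a `^ (al - 1).
Proof.
move=> al1 a0 b0; have := powR_tangent al1 a0 b0.
have := @mulr_powRB1 R a al a0 (lt_trans ltr01 al1).
by nra.
Qed.

Lemma powR_convex x y l al : 1 < al -> 0 <= x -> 0 <= y -> 0 <= l <= 1 ->
  (l * x + (1 - l) * y) `^ al <= l * x `^ al + (1 - l) * y `^ al.
Proof.
move=> al1 x0 y0 /andP[l0 l1]; set m := l * x + (1 - l) * y.
have l1' : 0 <= 1 - l by lra.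
have m0 : 0 <= m by rewrite addr_ge0// mulr_ge0.
have := ler_wpM2l l0 (powR_sub_le al1 m0 x0).
have := ler_wpM2l l1' (powR_sub_le al1 m0 y0).
set P := m `^ (al - 1) => hx hy.
have : l * (al * (m - x) * P) + (1 - l) * (al * (m - y) * P) = 0.
  by rewrite /m; ring.
lra.
Qed.

(** Both (a - b) a^(al - 1) and (a^ga - b^ga) a^(al - ga) dominate
    a^al - b^al up to a constant: the latter by the tangent inequality for the
    exponent al / ga, applied to a^ga and b^ga. *)
Lemma powR_sub_sq_le a b al ga : 0 < ga -> ga < al -> 1 < al ->
    0 <= b -> b <= a ->
  (a `^ al - b `^ al) ^+ 2 <=
  al ^+ 2 / ga * ((a - b) * (a `^ ga - b `^ ga)) * a `^ (2 * al - ga - 1).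
Proof.
move=> ga0 gaal al1 b0 ba; have a0 : 0 <= a := le_trans b0 ba.
have al0 : 0 < al by lra.
have h1 := powR_sub_le al1 a0 b0.
have alga : 1 < al / ga by rewrite ltr_pdivlMr// mul1r.
have h2 := powR_sub_le alga (powR_ge0 a ga) (powR_ge0 b ga).
move: h2; rewrite -!powRrM mulrCA divff ?gt_eqF// mulr1.
rewrite (_ : ga * (al / ga - 1) = al - ga); last by field; rewrite gt_eqF.
move=> h2; rewrite (_ : 2 * al - ga - 1 = (al - 1) + (al - ga)); last by ring.
rewrite powRD_ge0 ?subr_gt0//.
have d0 : 0 <= a `^ al - b `^ al by rewrite subr_ge0 ler_powR2// ltW.
rewrite expr2; apply: le_trans (ler_pM d0 d0 h1 h2) _.
rewrite le_eqVlt; apply/orP; left; apply/eqP.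
by field; rewrite gt_eqF.
Qed.

(** The previous inequality, with its geometric mean replaced by a weighted
    arithmetic mean; [e] is the free weight. *)
Lemma powR_sub_norm_le a b al ga e : 0 < ga -> ga < al -> 1 < al -> 0 < e ->
    0 <= a -> 0 <= b ->
  `|a `^ al - b `^ al| <=
  al ^+ 2 / ga / e * ((a - b) * (a `^ ga - b `^ ga)) +
  e * (a `^ (2 * al - ga - 1) + b `^ (2 * al - ga - 1)).
Proof.
move=> ga0 gaal al1 e0; wlog ba : a b / b <= a.
  move=> H a0 b0; have [ba|/ltW ab] := leP b a; first exact: H.
  by have := H _ _ ab b0 a0; rewrite distrC; lra.
move=> a0 b0; have al0 : 0 < al by lra.
rewrite ger0_norm ?subr_ge0 ?ler_powR2//; last exact: ltW.
set m := 2 * al - ga - 1; have Y0 := powR_ge0 a m; have Y'0 := powR_ge0 b m.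
have := powR_sub_sq_le ga0 gaal al1 b0 ba; rewrite -/m.
have X0 : 0 <= (a - b) * (a `^ ga - b `^ ga).
  by rewrite mulr_ge0 ?subr_ge0// ler_powR2// ltW.
have M0 : 0 <= al ^+ 2 / ga by rewrite divr_ge0 ?sqr_ge0// ltW.
move: X0 M0 Y0 Y'0; set X := _ * (_ - _); set M := al ^+ 2 / ga.
set Y := a `^ m; set Y' := b `^ m; set z := _ - _ => X0 M0 Y0 Y'0 zXY.
have eY : 0 <= e * (Y + Y') by rewrite mulr_ge0 ?addr_ge0// ltW.
have MX : 0 <= M / e * X by rewrite mulr_ge0// divr_ge0// ltW.
have [z0|z0] := leP z 0; first by rewrite (le_trans z0)// addr_ge0.
rewrite -(@ler_pXn2r _ 2)// ?nnegrE; [|exact: ltW|exact: addr_ge0].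
apply: le_trans zXY _.
have : 0 <= (M / e * X - e * (Y + Y')) ^+ 2 by exact: sqr_ge0.
have : (M / e * X) * (e * (Y + Y')) = M * X * Y + M * X * Y'.
  by field; rewrite gt_eqF.
have : 0 <= M * X * Y by rewrite mulr_ge0// mulr_ge0.
have : 0 <= M * X * Y' by rewrite mulr_ge0// mulr_ge0.
nra.
Qed.

(** Young's inequality with a crude constant: according to which of [x] and
    d * y^(1 / (p - 1)) is larger, one of the two terms alone suffices. *)
Lemma young_powR x y p d : 1 < p -> 0 < d -> 0 <= x -> 0 <= y ->
  x * y <= d * y `^ (p / (p - 1)) + d `^ (1 - p) * x `^ p.
Proof.
move=> p1 d0 x0 y0; have pB : 0 < p - 1 by lra.
have pp : 0 < (p - 1)^-1 by rewrite invr_gt0.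
have dE : 0 <= d * y `^ (p - 1)^-1 by rewrite mulr_ge0 ?powR_ge0// ltW.
have yE : y `^ (p / (p - 1)) = y * y `^ (p - 1)^-1.
  rewrite -[X in _ = X * _](powRr1 y0) -powRD_ge0//.
  by congr (_ `^ _); field; rewrite gt_eqF.
have [xd|/ltW dx] := leP x (d * y `^ (p - 1)^-1).
  rewrite yE (mulrCA d) mulrC ler_wpDr ?ler_wpM2l//.
  by rewrite mulr_ge0 ?powR_ge0.
rewrite ler_wpDl ?mulr_ge0 ?powR_ge0 ?(ltW d0)//.
have := @ler_powR2 _ _ (p - 1) (ltW pB) dE dx.
rewrite powRM ?powR_ge0 ?(ltW d0)// powRVK ?gt_eqF// => H.
rewrite -(@mulr_powRB1 _ x p)//; last by lra.
rewrite (_ : 1 - p = - (p - 1)); last by ring.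
rewrite powRN mulrCA ler_wpM2l// -ler_pdivrMl ?invr_gt0 ?powR_gt0//.
by rewrite invrK.
Qed.

End PowR.

(** * Words and translations *)

Section Words.
Variables (G : groupType) (S : set G).

Lemma joined_by_wordP (x y : G) (n : nat) :
  joined_by_word S x y n <->
  exists2 r : seq G, size r = n /\ {in r, forall z, S z}
    & y = (x * \prod_(z <- r) z)%g.
Proof.
split=> [[w [wS ->]]|[r [<- rS] ->]].
  exists w; last by rewrite big_tuple.
  by split=> [|z /tnthP[i ->]//]; rewrite size_tuple.
exists (in_tuple r); split; last by rewrite (big_tnth _ _ r).
by move=> i; apply: rS; exact: mem_tnth.
Qed.

Lemma symmetric_setV (s : G) : symmetric_set S -> S s -> S s^-1%g.
Proof. by move=> Ssym Ss; rewrite -Ssym; exists s. Qed.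

(** The elements that are products of generators, together with their inverse,
    form a subgroup containing [S]. *)
Lemma joined_by_word_exists (x : G) : generates S -> symmetric_set S ->
  exists n, joined_by_word S 1%g x n.
Proof.
move=> Sgen Ssym.
pose W := [set y : G | exists2 r : seq G, {in r, forall z, S z}
                                        & y = (\prod_(z <- r) z)%g].
(* Requiring a word for y^-1 as well makes closure under inverses trivial. *)
pose H := [set y : G | W y /\ W y^-1%g].
have WM y z : W y -> W z -> W (y * z)%g.
  move=> [r rS ->] [r' r'S ->]; exists (r ++ r'); last by rewrite big_cat.
  by move=> t; rewrite mem_cat => /orP[/rS|/r'S].
have W1 : W 1%g by exists [::]; rewrite ?big_nil.
have W_S s : S s -> W s.
  by exists [:: s]; rewrite ?big_seq1// => z; rewrite inE => /eqP ->.
have Hx : H x.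
  have : [set: G] x by [].
  rewrite -Sgen; apply; split; last first.
    by move=> s Ss; split; apply: W_S => //; exact: symmetric_setV.
  split=> [|y z [Wy Wy'] [Wz Wz']|y [Wy Wy']].
  - by split; rewrite ?invg1.
  - by split; rewrite ?invgM; exact: WM.
  - by split; rewrite ?invgK.
have [[r rS ->] _] := Hx; exists (size r); apply/joined_by_wordP.
by exists r; rewrite ?mul1g.
Qed.

Lemma word_ballP (x : G) (n : nat) : generates S -> symmetric_set S ->
    word_ball S n x ->
  exists2 r : seq G, (size r <= n)%N /\ {in r, forall z, S z}
    & x = (\prod_(z <- r) z)%g.
Proof.
move=> Sgen Ssym; rewrite /word_ball/= /word_distance => xn.
have [m0 xm0] := joined_by_word_exists x Sgen Ssym.
have : exists k, `[< joined_by_word S 1%g x k >] by exists m0; apply/asboolP.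
move=> /ex_minnP[k /asboolP xk kmin].
have := @getPex nat [set n | joined_by_word S 1%g x n /\
               forall m, joined_by_word S 1%g x m -> (n <= m)%N].
case.
  by exists k; split=> // m xm; apply: kmin; apply/asboolP.
move=> /joined_by_wordP[r [rn rS] ->] _; exists r; last by rewrite mul1g.
by rewrite rn.
Qed.

Lemma steps_sumV (R : realType) (F : G -> R) : finite_set S ->
    symmetric_set S ->
  \sum_(s <- fset_set S) F s^-1%g = \sum_(s <- fset_set S) F s.
Proof.
move=> Sfin Ssym; rewrite -!fsbig_finite//; symmetry.
apply: (reindex_fsbig (fun x => x^-1%g)); split=> [s Ss|s t _ _|s Ss].
- exact: symmetric_setV.
- exact: invg_inj.
- by exists s^-1%g; rewrite ?invgK//; exact: symmetric_setV.
Qed.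

Lemma laplacianE (R : realType) (u : G -> R) (x : G) : finite_set S ->
  laplacian S u x = \sum_(s <- fset_set S) (u (x * s)%g - u x).
Proof.
move=> Sfin; rewrite -fsbig_finite// /laplacian.
apply: (reindex_fsbig (fun s => (x * s)%g)).
split=> [s Ss|s t _ _|y [s Ss ->]]; first by exists s.
- exact: mulgI.
- by exists s.
Qed.

Lemma laplacianEcard (R : realType) (u : G -> R) (x : G) : finite_set S ->
  laplacian S u x =
  \sum_(s <- fset_set S) u (x * s)%g - #|` fset_set S|%:R * u x.
Proof.
move=> Sfin; rewrite laplacianE// sumrB; congr (_ - _).
by rewrite big_const_seq iter_addr_0 count_predT mulr_natl.
Qed.

End Words.

Section Translation.
Variables (R : realType) (G : groupType).
Implicit Types (u w : G -> R) (g : G).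

Lemma total_shift u g : total (fun x => u (x * g)%g) = total u.
Proof.
apply: total_bij; exists (fun x => x * g^-1)%g => x.
- by rewrite mulgK.
- by rewrite mulgVK.
Qed.

Definition variation (S : set G) w : \bar R :=
  total (fun x => \sum_(s <- fset_set S) `|w (x * s)%g - w x|).

Lemma variation_ge0 (S : set G) w : (0 <= variation S w)%E.
Proof. by apply: total_ge0 => x; rewrite sumr_ge0. Qed.

(** A word moves a point along its letters, and every letter costs at most one
    copy of the variation. *)
Lemma total_translate_le (S : set G) w (r : seq G) : finite_set S ->
    {in r, forall z, S z} ->
  (total (fun x => `|w (x * \prod_(z <- r) z)%g - w x|)%R <=
   (size r)%:R%:E * variation S w)%E.
Proof.
move=> Sfin; elim: r => [|s r IH] rS.
  by rewrite mul0e -[leRHS](@total0 R G); apply: le_total => x;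
    rewrite big_nil mulg1 subrr normr0.
have sS : s \in fset_set S.
  by rewrite in_fset_set// inE; apply: rS; rewrite mem_head.
have {}IH := IH (fun z zr => rS z (mem_behead (s := s :: r) zr)).
set P := (\prod_(z <- r) z)%g in IH *.
apply: (@le_trans _ _ (total (fun x => `|w (x * s * P)%g - w (x * s)%g| +
                                       `|w (x * s)%g - w x|)%R)).
  apply: le_total => x; rewrite big_cons -/P mulgA.
  by rewrite (le_trans _ (ler_normD _ _))// addrA subrK.
rewrite totalD//=.
rewrite (@total_shift (fun y => `|w (y * P)%g - w y|) s).
rewrite -natr1 EFinD ge0_muleDl ?lee_fin// mul1e leeD//.
apply: le_total => x.
rewrite (big_rem s)//= lerDl sumr_ge0//.
Qed.

End Translation.

(** * The isoperimetric inequality *)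

(** As [fset_set] of an infinite set is empty, this lets the balls be used
    without proving them finite. *)
Lemma fset_set_mem (T : choiceType) (A : set T) (x : T) :
  x \in fset_set A -> A x.
Proof.
have [Afin|Afin] := pselect (finite_set A).
  by rewrite in_fset_set// inE.
by rewrite /fset_set; case: pselect.
Qed.

Lemma sume_const_seq (R : realType) (T : Type) (r : seq T) (x : \bar R) :
  (0 <= x)%E -> (\sum_(t <- r) x = (size r)%:R%:E * x)%E.
Proof.
move=> x0; elim: r => [|t r IH]; first by rewrite big_nil mul0e.
by rewrite big_cons IH/= -nat1r EFinD ge0_muleDl ?lee_fin// mul1e.
Qed.

Section Isoperimetry.
Variables (R : realType) (G : groupType) (S : set G).
Hypotheses (S_finite : finite_set S) (S_gen : generates S)
  (S_sym : symmetric_set S).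
Implicit Types (w : G -> R).

Definition ind (A : {fset G}) (x : G) : R := (x \in A)%:R.

Lemma total_ind A : total (ind A) = #|` A|%:R%:E.
Proof.
rewrite (@total_supp _ _ _ A) => [|x|x /negPf xA]; rewrite /ind ?xA//.
rewrite (eq_big_seq (fun=> 1)) => [|x ->//].
by rewrite big_const_seq iter_addr_0 count_predT.
Qed.

(** Sum over g in the ball the bound n * variation on the l^1 distance between
    the indicator of A and its translate by g; a point x of A contributes to the
    left-hand sides for at least #|ball| - #|A| values of g, because g |-> x g
    is injective. *)
Lemma variation_ball_le A n :
  (((#|` A|%:R * (growth S n)%:R - #|` A|%:R ^+ 2))%:E <=
   (growth S n)%:R%:E * (n%:R%:E * variation S (ind A)))%E.
Proof.
set B := fset_set (word_ball S n); set V := variation S (ind A).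
have -> : growth S n = #|` B| by [].
have BV : (\sum_(g <- B) total (fun x => `|ind A (x * g)%g - ind A x|)%R <=
           #|` B|%:R%:E * (n%:R%:E * V))%E.
  rewrite -sume_const_seq ?mule_ge0 ?variation_ge0 ?lee_fin//.
  rewrite big_seq [leRHS]big_seq; apply: lee_sum => g gB.
  have [r [rn rS] ->] := word_ballP S_gen S_sym (fset_set_mem gB).
  apply: le_trans (total_translate_le _ S_finite rS) _.
  by rewrite lee_wpmul2r ?variation_ge0// lee_fin ler_nat.
apply: le_trans BV; rewrite -total_sum//.
have [An|nA] := leP #|` A|%:R (#|` B|%:R : R); last first.
  apply: (@le_trans _ _ 0%E); last by apply: total_ge0 => x; rewrite sumr_ge0.
  rewrite lee_fin expr2 -mulrBr mulr_ge0_le0//; lra.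
rewrite expr2 -mulrBr mulrC EFinM -total_ind -totalZ ?subr_ge0//.
apply: le_total => x; have [xA|xA] := boolP (x \in A); last first.
  by rewrite {1}/ind (negPf xA) mulr0 sumr_ge0.
rewrite {1}/ind xA mulr1 (@le_trans _ _ (\sum_(g <- B) (1 - ind A (x * g)%g)))//.
  rewrite sumrB big_const_seq iter_addr_0 count_predT lerD2l lerN2.
  rewrite -lee_fin -total_ind; apply: le_trans (sum_le_total _ _) _ => //.
  rewrite (@total_bij _ _ (ind A) (fun g => x * g)%g)//.
  by exists (fun g => x^-1 * g)%g => g; rewrite ?mulKg ?mulVKg.
have -> : ind A x = 1 by rewrite /ind xA.
by apply: ler_sum => g _; rewrite distrC ler_norm.
Qed.

(** The radius is chosen of order #|A|^(1/N), just large enough for the ball to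
    have at least 2 #|A| elements. *)
Lemma isoperimetric_inequality N : (2 <= N)%N -> polynomial_growth R S N ->
  exists2 K : R, 0 < K & forall A : {fset G},
    ((#|` A|%:R `^ (1 - N%:R^-1))%:E <= K%:E * variation S (ind A))%E.
Proof.
move=> N2 [C1 [C2 [C10 _ growthN]]].
have N0 : 0 < N%:R :> R by rewrite ltr0n (leq_trans _ N2).
have NI0 : 0 < N%:R^-1 :> R by rewrite invr_gt0.
have NI1 : N%:R^-1 < 1 :> R by rewrite invf_lt1// ltr1n.
pose k : R := (2 / C1) `^ N%:R^-1 + 1.
have k0 : 0 < k by rewrite ltr_wpDl// powR_ge0.
exists (2 * k); first by rewrite mulr_gt0.
move=> A; have [->|A0] := eqVneq A fset0.
  rewrite cardfs0 powR0 ?subr_eq0 ?gt_eqF// mule_ge0 ?variation_ge0//.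
  by rewrite lee_fin ltW// mulr_gt0.
have n1 : 1 <= #|` A|%:R :> R by rewrite ler1n cardfs_gt0.
have n0 : 0 < #|` A|%:R :> R by lra.
move: n1 n0; set n := #|` A|%:R => n1 n0.
pose t : R := (2 * n / C1) `^ N%:R^-1.
have t0 : 0 <= t by exact: powR_ge0.
pose r := (Num.truncn t).+1.
have tr : t <= r%:R by rewrite ltW// truncnS_gt.
have rk : r%:R <= k * n `^ N%:R^-1.
  rewrite -natr1; apply: (@le_trans _ _ (t + 1)).
    by rewrite lerD2r truncn_le.
  rewrite mulrDl mul1r /t mulrAC powRM ?(ltW n0)//; last first.
    by rewrite divr_ge0 ?(ltW C10).
  rewrite lerD2l -[leLHS](powRr0 n) ler_powR//; exact: ltW.
have growth_ge : 2 * n <= (growth S r)%:R.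
  have /andP[+ _] := growthN r isT; apply: le_trans.
  rewrite -ler_pdivrMl// mulrC -powR_mulrn//.
  rewrite -[leLHS](@powRVK _ _ N%:R) ?gt_eqF//; last first.
    by rewrite divr_ge0 ?mulr_ge0 ?(ltW n0) ?(ltW C10).
  by apply: ler_powR2 => //; exact: ltW.
have := variation_ball_le A r; rewrite -/n.
move: (variation_ge0 S (ind A)); case: (variation S (ind A)) => [v| |] //; last first.
  by move=> _ _; rewrite gt0_muley ?leey// lte_fin mulr_gt0.
rewrite lee_fin -!EFinM !lee_fin => v0 Hv.
have b0 : 0 < (growth S r)%:R :> R by rewrite (lt_le_trans _ growth_ge)// mulr_gt0.
have {}Hv : n <= 2 * (r%:R * v).
  rewrite -(@ler_pM2l _ (growth S r)%:R)//.
  have : n * (2 * n) <= n * (growth S r)%:R by rewrite ler_wpM2l// ltW.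
  by move: Hv; rewrite expr2; nra.
rewrite powRB ?gt_eqF ?implybT//  powRr1 ?(ltW n0)// ler_pdivrMr ?powR_gt0//.
have : r%:R * v <= k * n `^ N%:R^-1 * v by rewrite ler_wpM2r.
lra.
Qed.

End Isoperimetry.

(** * From isoperimetry to the Sobolev inequality for the gradient *)

(** Minkowski's inequality for finite sums, with upper bounds instead of norms;
    it is the convexity of the power function after normalisation. *)
Lemma minkowski_sum (R : realType) (T : eqType) (r : seq T) (f g : T -> R)
    (a P Q : R) :
    1 < a -> (forall x, 0 <= f x) -> (forall x, 0 <= g x) -> 0 <= P -> 0 <= Q ->
    \sum_(x <- r) f x `^ a <= P `^ a -> \sum_(x <- r) g x `^ a <= Q `^ a ->
  \sum_(x <- r) (f x + g x) `^ a <= (P + Q) `^ a.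
Proof.
move=> a1 f0 g0; have a0 : a != 0 by rewrite gt_eqF//; lra.
have vanish (h : T -> R) : (forall x, 0 <= h x) ->
    \sum_(x <- r) h x `^ a <= 0 `^ a -> {in r, forall x, h x = 0}.
  move=> h0; rewrite powR0// => hr x xr; apply/eqP.
  have : \sum_(x <- r) h x `^ a == 0.
    by rewrite eq_le hr sumr_ge0// => *; exact: powR_ge0.
  rewrite psumr_eq0 => [|*]; last exact: powR_ge0.
  by move=> /allP/(_ _ xr); rewrite powR_eq0 a0 andbT.
rewrite le_eqVlt => /predU1P[<- _ /(vanish f f0) fr|P0].
  rewrite add0r; apply: le_trans; rewrite big_seq [leRHS]big_seq.
  by apply: ler_sum => x xr; rewrite fr// add0r.
rewrite le_eqVlt => /predU1P[<- + /(vanish g g0) gr|Q0 fP gQ].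
  rewrite addr0; apply: le_trans; rewrite big_seq [leRHS]big_seq.
  by apply: ler_sum => x xr; rewrite gr// addr0.
set l := P / (P + Q); have PQ0 : 0 < P + Q by rewrite addr_gt0.
have l01 : 0 <= l <= 1.
  by rewrite /l divr_ge0 ?(ltW P0) ?(ltW PQ0)//= ler_pdivrMr// mul1r lerDl ltW.
have fg x : (f x + g x) `^ a <=
    (P + Q) `^ a * (l / P `^ a * f x `^ a + (1 - l) / Q `^ a * g x `^ a).
  have -> : f x + g x = (P + Q) * (l * (f x / P) + (1 - l) * (g x / Q)).
    by rewrite /l; field; rewrite !gt_eqF.
  have := powR_convex a1 (divr_ge0 (f0 x) (ltW P0)) (divr_ge0 (g0 x) (ltW Q0)) l01.
  have [l0 l1] := andP l01.
  rewrite powRM ?(ltW PQ0)//; last first.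
    apply: addr_ge0; apply: mulr_ge0; rewrite ?subr_ge0//.
    - exact: divr_ge0 (f0 x) (ltW P0).
    - exact: divr_ge0 (g0 x) (ltW Q0).
  move=> /(ler_wpM2l (powR_ge0 (P + Q) a)) /le_trans; apply.
  have divE u v : 0 <= u -> 0 < v -> (u / v) `^ a = u `^ a / v `^ a.
    move=> u0 v0; rewrite powRM ?invr_ge0 ?(ltW v0)//; congr (_ * _).
    by rewrite -[v^-1]powR_inv1 ?(ltW v0)// powRAC powR_inv1// powR_ge0.
  rewrite !divE// ler_wpM2l ?powR_ge0// le_eqVlt; apply/orP; left; apply/eqP.
  by field; rewrite !gt_eqF// powR_gt0.
apply: le_trans (ler_sum _ (fun x _ => fg x)) _.
rewrite -mulr_sumr -[leRHS]mulr1 ler_wpM2l ?powR_ge0// big_split/= -!mulr_sumr.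
have [l0 l1] := andP l01.
have := ler_wpM2l (divr_ge0 l0 (powR_ge0 P a)) fP.
have : 0 <= (1 - l) / Q `^ a by rewrite divr_ge0 ?powR_ge0// subr_ge0.
move=> /ler_wpM2l/(_ _ _ gQ); rewrite !divfK ?gt_eqF ?powR_gt0//; lra.
Qed.

Lemma seq_argmin (R : realType) (T : eqType) (r : seq T) (f : T -> R) :
  r != [::] -> exists2 x, x \in r & {in r, forall y, f x <= f y}.
Proof.
elim: r => // x [|y r] IH _.
  by exists x; rewrite ?mem_head// => y; rewrite inE => /eqP ->.
have [//|z zr zmin] := IH; have [xz|zx] := leP (f x) (f z).
  exists x; rewrite ?mem_head// => t; rewrite in_cons => /predU1P[->//|tr].
  exact: le_trans xz (zmin _ tr).
exists z; first by rewrite in_cons zr orbT.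
by move=> t; rewrite in_cons => /predU1P[->|/zmin//]; exact: ltW.
Qed.

Section GradientSobolev.
Variables (R : realType) (G : groupType) (S : set G).
Implicit Types (w : G -> R).

(** The functions w - c 1_A and 1_A are comonotone, so that their increments
    along each edge have the same sign and the variations add up exactly. *)
Lemma variation_peel w (c : R) (A : {fset G}) : 0 <= c ->
    (forall x, x \notin A -> w x = 0) -> {in A, forall x, c <= w x} ->
  variation S w =
  (variation S (fun x => w x - c * ind R A x)%R +
   c%:E * variation S (ind R A))%E.
Proof.
move=> c0 wA cA; rewrite /variation -totalZ//; last by move=> x; rewrite sumr_ge0.
rewrite -totalD; [|by move=> x; rewrite sumr_ge0|]; last first.
  by move=> x; rewrite mulr_ge0// sumr_ge0.
apply: eq_total => x; rewrite mulr_sumr -big_split/=; apply: eq_bigr => s _.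
rewrite /ind; have [xA|xA] := boolP (x \in A);
  have [yA|yA] := boolP ((x * s)%g \in A); rewrite ?(wA _ xA) ?(wA _ yA).
- by rewrite subrr normr0 !mulr0 addr0; congr (`| _ |); ring.
- have := cA _ xA => cx.
  rewrite !(mulr1, mulr0, subr0, sub0r, oppr0, normrN, normr1).
  by rewrite !ger0_norm ?subr_ge0//; lra.
- have := cA _ yA => cy; rewrite !(mulr1, mulr0, subr0, normr1).
  by rewrite !ger0_norm ?subr_ge0//; lra.
- by rewrite !(mulr0,subr0,normr0,addr0).
Qed.

(** Layer-cake argument, one layer at a time: with c the minimum of w on A,
    w - c 1_A has a smaller support, the variation is additive, and
    Minkowski's inequality adds the bounds for the two parts. *)
Lemma gradient_sobolev (a K : R) : 1 < a -> 0 <= K ->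
    (forall A : {fset G},
      ((#|` A|%:R `^ a^-1)%:E <= K%:E * variation S (ind R A))%E) ->
  forall w d, (forall x, 0 <= w x) -> finitely_supported w ->
    variation S w = d%:E -> (total (fun x => w x `^ a)%R <= ((K * d) `^ a)%:E)%E.
Proof.
move=> a1 K0 iso w d w0 /finitely_supportedP[A wA] wd.
have a0 : a != 0 by rewrite gt_eqF//; lra.
have [n] := ubnP #|` A|; elim: n => // n IH in A w d w0 wA wd *.
rewrite ltnS => An.
rewrite (@total_supp _ _ _ A); first last.
- by move=> x /wA ->; rewrite powR0.
- by move=> x; exact: powR_ge0.
have [->|A0] := eqVneq A fset0.
  by rewrite big_seq_fset0 lee_fin powR_ge0.
have [x0 x0A x0min] : exists2 x, x \in A & {in A, forall y, w x <= w y}.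
  apply: (@seq_argmin R G (enum_fset A) w).
  by apply: contra_neq A0 => A0; apply: val_inj; rewrite /= A0.
have An' : (#|` (A `\ x0)%fset| < n)%N.
  by rewrite (leq_trans _ An)// [ltnRHS](cardfsD1 x0) x0A.
(* If w vanishes at x0, removing x0 from A leaves w unchanged; the layer is
   peeled only when c > 0, which makes the variation of 1_A finite. *)
set c := w x0; have [c0|cn0] := eqVneq c 0.
  rewrite -(@total_supp _ _ (fun x => w x `^ a) A); first last.
  - by move=> x /wA ->; rewrite powR0.
  - by move=> x; exact: powR_ge0.
  apply: (IH (A `\ x0)%fset) => // x.
  by rewrite in_fsetD1 negb_and negbK => /predU1P[->//|/wA].
have {cn0} c_gt0 : 0 < c by rewrite lt_def cn0 w0.
have c0 := ltW c_gt0.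
pose w' x := w x - c * ind R A x.
have w'0 x : 0 <= w' x.
  rewrite /w' /ind; have [xA|xA] := boolP (x \in A).
    by rewrite mulr1 subr_ge0 x0min.
  by rewrite mulr0 subr0.
have w'A x : x \notin (A `\ x0)%fset -> w' x = 0.
  rewrite in_fsetD1 negb_and negbK /w' /ind => /orP[/eqP ->|xA].
    by rewrite x0A mulr1 subrr.
  by rewrite (negPf xA) wA// mulr0 subr0.
have := @variation_peel w c A c0 wA x0min; rewrite wd -/w'.
move: (variation_ge0 S w') (variation_ge0 S (ind R A)) (iso A).
case wd' : (variation S w') => [d'| |]//; last first.
  by move=> _ I0 _; rewrite addye// -ltNye (lt_le_trans _ (mule_ge0 _ I0)) ?lee_fin.
case: (variation S (ind R A)) => [v| |]//.
  2: by move=> _ _ _; rewrite gt0_muley ?lte_fin// addey.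
rewrite -!EFinM -EFinD !lee_fin => d'0 v0 Av [dE].
have := IH _ _ _ w'0 w'A wd' An'.
rewrite (@total_supp _ _ _ A) ?lee_fin; first last.
- by move=> x xA; rewrite w'A ?powR0// in_fsetD1 (negPf xA) andbF.
- by move=> x; exact: powR_ge0.
move=> w'K; rewrite (eq_big_seq (fun x => (w' x + c) `^ a)); last first.
  by move=> x xA; rewrite /w' /ind xA mulr1 subrK.
rewrite dE mulrDr; apply: minkowski_sum => //.
- exact: mulr_ge0.
- by rewrite !mulr_ge0.
- rewrite big_const_seq iter_addr_0 count_predT -mulr_natr mulrCA.
  rewrite (@powRM _ c)//; last exact: mulr_ge0.
  rewrite ler_wpM2l ?powR_ge0// -[leLHS](@powRVK _ _ a)//.
  by apply: ler_powR2; rewrite ?powR_ge0//; lra.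
Qed.


End GradientSobolev.

(** * The second-order Sobolev inequality *)

Section Energy.
Variables (R : realType) (G : groupType) (S : set G).
Hypotheses (S_finite : finite_set S) (S_sym : symmetric_set S).
Implicit Types (u v h : G -> R).

(** This says -Delta v <= h, written without subtraction. *)
Definition subsolution v h :=
  forall x, #|` fset_set S|%:R * v x <=
            \sum_(s <- fset_set S) v (x * s)%g + h x.

(** Twice the pairing of -Delta v with v^ga, as an edge sum of nonnegative
    terms. *)
Definition energy ga v : \bar R :=
  total (fun x => \sum_(s <- fset_set S)
                    (v x - v (x * s)%g) * (v x `^ ga - v (x * s)%g `^ ga)).

Lemma energy_term_ge0 ga a b : 0 <= ga -> 0 <= a -> 0 <= b ->
  0 <= (a - b) * (a `^ ga - b `^ ga) :> R.
Proof.
move=> ga0 a0 b0; have [ab|/ltW ba] := leP a b.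
  by rewrite mulr_le0// subr_le0// ler_powR2.
by rewrite mulr_ge0// subr_ge0// ler_powR2.
Qed.

(** Summation by parts. To stay within nonnegative sums, the cross terms, whose
    total is the same finite number whichever end of the edge carries the
    power, are added to both sides and cancelled at the end. *)
Lemma energy_le ga v h : 0 < ga -> (forall x, 0 <= v x) ->
    (forall x, 0 <= h x) -> finitely_supported v -> subsolution v h ->
  (energy ga v <= 2%:E * total (fun x => h x * v x `^ ga)%R)%E.
Proof.
move=> ga0 v0 h0 vfin vh; have ga_ge0 := ltW ga0.
set d : R := #|` fset_set S|%:R; have d0 : 0 <= d by [].
pose A x := \sum_(s <- fset_set S) v (x * s)%g * v x `^ ga.
pose A' x := \sum_(s <- fset_set S) v x * v (x * s)%g `^ ga.
pose F x := v x * v x `^ ga.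
have F0 x : 0 <= F x by rewrite mulr_ge0 ?powR_ge0.
have p0 a b : 0 <= v a * v b `^ ga by rewrite mulr_ge0 ?powR_ge0.
have A0 x : 0 <= A x by rewrite sumr_ge0.
have A'0 x : 0 <= A' x by rewrite sumr_ge0.
have hv0 x : 0 <= h x * v x `^ ga by rewrite mulr_ge0 ?powR_ge0.
have AA' : total A' = total A.
  rewrite /A' total_sum//.
  rewrite (_ : A = fun x => \sum_(s <- fset_set S) v (x * s^-1)%g * v x `^ ga).
    rewrite total_sum//; apply: eq_bigr => s _.
    rewrite -(total_shift (fun x => v (x * s^-1)%g * v x `^ ga) s).
    by apply: eq_total => x; rewrite mulgK.
  apply/funext => x.
  by rewrite (steps_sumV (fun s => v (x * s)%g * v x `^ ga)).
have FS : total (fun x => \sum_(s <- fset_set S) F (x * s)%g) = (d%:E * total F)%E.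
  rewrite total_sum//; under eq_bigr do rewrite total_shift.
  by rewrite sume_const_seq// total_ge0.
have [a a0 aE] : exists2 a : R, 0 <= a & total A = a%:E.
  apply: total_fin => //; apply: sub_finite_set vfin => x /=.
  apply: contra_neq => vx; rewrite /A big1// => s _.
  by rewrite vx powR0 ?mulr0// gt_eqF.
have dF : (d%:E * total F <= a%:E + total (fun x => h x * v x `^ ga)%R)%E.
  rewrite -totalZ// -?aE -?totalD//.
  apply: le_total => x; rewrite /A -mulr_suml -mulrDl /F mulrA ler_wpM2r ?powR_ge0//.
have e0 x : 0 <= \sum_(s <- fset_set S)
                    (v x - v (x * s)%g) * (v x `^ ga - v (x * s)%g `^ ga).
  by rewrite sumr_ge0// => s _; exact: energy_term_ge0.
have : (energy ga v + (a + a)%:E = 2%:E * (d%:E * total F))%E.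
  rewrite EFinD -!aE -{1}AA' -!totalD//; last by move=> x; rewrite addr_ge0.
  rewrite mule_natl mule2n -{1}FS -totalZ// -totalD//; last 2 first.
  - by move=> x; rewrite sumr_ge0.
  - by move=> x; rewrite mulr_ge0.
  apply: eq_total => x; rewrite /A /A'.
  have -> : d * F x = \sum_(s <- fset_set S) F x.
    by rewrite big_const_seq iter_addr_0 count_predT mulr_natl.
  rewrite -!big_split/=; apply: eq_bigr => s _; rewrite /F; ring.
move=> eE; rewrite -(@leeD2rE _ (a + a)%:E)//.
rewrite eE; apply: (le_trans (lee_wpmul2l _ dF)) => //.
rewrite ge0_muleDr ?lee_fin ?total_ge0// addeC leeD2l// -EFinM lee_fin; lra.
Qed.

End Energy.

Section Sobolev.
Variables (R : realType) (G : groupType) (S : set G).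
Hypotheses (S_finite : finite_set S) (S_gen : generates S)
  (S_sym : symmetric_set S).
Implicit Types (u v h : G -> R).

(** Every vertex occurs in 2 d of the pairs (x, x s), which gives the factor of
    the last term. *)
Lemma variation_powR_le al ga e v : 0 < ga -> ga < al -> 1 < al -> 0 < e ->
    (forall x, 0 <= v x) ->
  (variation S (fun x => v x `^ al)%R <=
   (al ^+ 2 / ga / e)%:E * energy S ga v +
   (e * (2 * #|` fset_set S|%:R))%:E *
     total (fun x => v x `^ (2 * al - ga - 1))%R)%E.
Proof.
move=> ga0 gaal al1 e0 v0; set M := al ^+ 2 / ga / e; set m := _ - 1.
have M0 : 0 <= M by rewrite /M divr_ge0 ?(ltW e0)// divr_ge0 ?sqr_ge0// ltW.
have mE : ((e * (2 * #|` fset_set S|%:R))%:E * total (fun x => v x `^ m)%R =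
    total (fun x => \sum_(s <- fset_set S) (e * (v x `^ m + v (x * s)%g `^ m))%R)%R)%E.
  rewrite total_sum; last first.
    by move=> s x; rewrite mulr_ge0 ?addr_ge0 ?powR_ge0// ltW.
  have t0 : (0 <= total (fun x => v x `^ m)%R)%E.
    by apply: total_ge0 => x; exact: powR_ge0.
  rewrite (eq_bigr (fun=> (e * 2)%:E * total (fun x => v x `^ m)%R))%E; last first.
    move=> s _; rewrite totalZ ?(ltW e0)//; last first.
      by move=> x; rewrite addr_ge0 ?powR_ge0.
    rewrite totalD; [|by move=> x; exact: powR_ge0..].
    rewrite (total_shift (fun x => v x `^ m)) EFinM -muleA; congr (_ * _)%E.
    by rewrite mule_natl mule2n.
  rewrite sume_const_seq; last by rewrite mule_ge0// lee_fin mulr_ge0// ltW.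
  by rewrite mulrA mulrC EFinM -muleA.
rewrite mE -totalZ//; last first.
  by move=> x; rewrite sumr_ge0// => s _; exact: energy_term_ge0 (ltW ga0) _ _.
rewrite -totalD; first last.
- by move=> x; rewrite sumr_ge0// => s _; rewrite mulr_ge0 ?addr_ge0 ?powR_ge0// ltW.
- move=> x; rewrite mulr_ge0// sumr_ge0// => s _.
  exact: energy_term_ge0 (ltW ga0) _ _.
apply: le_total => x; rewrite mulr_sumr -big_split/=; apply: ler_sum => s _.
by rewrite distrC; exact: powR_sub_norm_le.
Qed.

Variables (N : nat) (p : R).
Hypotheses (N_ge2 : (2 <= N)%N) (G_growth : polynomial_growth R S N)
  (p_gt1 : 1 < p) (p_lt : p < N%:R / 2).

Let q : R := N%:R * p / (N%:R - 2 * p).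

Lemma critical_exponent_gt0 : 0 < q.
Proof.
have N0 : 0 < N%:R :> R by rewrite ltr0n (leq_trans _ N_ge2).
by rewrite /q divr_gt0 ?mulr_gt0//; move: p_gt1 p_lt; lra.
Qed.

(** The variation of v^al is at least 1 / K by [gradient_sobolev]. It is also
    at most a constant times the energy plus a multiple of the weight [e], and
    the energy is controlled by the p-norm of [h] plus a multiple of the weight
    [dl]. *)
Lemma sobolev_normalized : exists2 c : R, 0 < c & forall v h,
  (forall x, 0 <= v x) -> (forall x, 0 <= h x) -> finitely_supported v ->
  subsolution S v h -> total (fun x => v x `^ q)%R = 1%E ->
  (c%:E <= total (fun x => h x `^ p)%R)%E.
Proof.
have [K K0 iso] := isoperimetric_inequality S_finite S_gen S_sym N_ge2 G_growth.
have N0 : 0 < N%:R :> R by rewrite ltr0n (leq_trans _ N_ge2).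
have N2 : 2 <= N%:R :> R by rewrite ler_nat.
have p1 := p_gt1; have p0 : 0 < p by lra.
have Np : 0 < N%:R - 2 * p by move: p_lt; lra.
have q0 := critical_exponent_gt0.
pose a : R := (1 - N%:R^-1)^-1.
have NI : N%:R^-1 < 1 :> R by rewrite invf_lt1//; lra.
have NI0 : 0 < N%:R^-1 :> R by rewrite invr_gt0.
have a1 : 1 < a by rewrite /a invf_gt1; lra.
pose al := q * (1 - N%:R^-1); pose ga := q * (1 - p^-1).
have alE : al = p * (N%:R - 1) / (N%:R - 2 * p).
  by rewrite /al /q; field; rewrite !gt_eqF.
have gaE : ga = N%:R * (p - 1) / (N%:R - 2 * p).
  by rewrite /ga /q; field; rewrite !gt_eqF.
have ga0 : 0 < ga by rewrite gaE divr_gt0// mulr_gt0//; lra.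
have gaal : ga < al.
  by rewrite gaE alE ltr_pM2r ?invr_gt0//; nra.
have al1 : 1 < al by rewrite alE ltr_pdivlMr//; nra.
have mE : 2 * al - ga - 1 = q.
  by rewrite gaE alE /q; field; rewrite gt_eqF.
have ala : al * a = q.
  by rewrite /al /a -mulrA divff ?mulr1//; rewrite gt_eqF//; lra.
have gap : ga * (p / (p - 1)) = q.
  by rewrite gaE /q; field; rewrite !gt_eqF//; lra.
set d : R := #|` fset_set S|%:R; have d0 : 0 <= d by [].
pose M := al ^+ 2 / ga; have M0 : 0 < M by rewrite /M divr_gt0// exprn_gt0//; lra.
(* The weights make each of the two terms that do not involve h at most 1/4
   after multiplication by K, which leaves 1/2 for the term with h. *)
pose e := (8 * K * (d + 1))^-1.
have e0 : 0 < e by rewrite invr_gt0 !mulr_gt0//; lra.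
pose dl := e / (8 * K * M).
have dl0 : 0 < dl by rewrite divr_gt0// mulr_gt0// mulr_gt0.
pose B := 4 * K * M / e * dl `^ (1 - p).
have B0 : 0 < B by rewrite mulr_gt0 ?powR_gt0// divr_gt0// mulr_gt0// mulr_gt0.
exists B^-1; first by rewrite invr_gt0.
move=> v h v0 h0 vfin vh v1; have vq0 x : 0 <= v x `^ q by exact: powR_ge0.
have := energy_le S_finite S_sym ga0 v0 h0 vfin vh.
have hv : (total (fun x => h x * v x `^ ga)%R <=
           dl%:E + (dl `^ (1 - p))%:E * total (fun x => h x `^ p)%R)%E.
  rewrite -[dl%:E]mule1 -v1 -(totalZ (ltW dl0))// -totalZ ?powR_ge0//; last first.
    by move=> x; exact: powR_ge0.
  rewrite -totalD; first last.
  - by move=> x; rewrite mulr_ge0 ?powR_ge0.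
  - by move=> x; rewrite mulr_ge0// ltW.
  apply: le_total => x.
  have := young_powR p_gt1 dl0 (h0 x) (powR_ge0 (v x) ga).
  by rewrite -powRrM gap.
have w0 x : 0 <= v x `^ al by exact: powR_ge0.
have wfin : finitely_supported (fun x => v x `^ al).
  apply: sub_finite_set vfin => x /=; apply: contra_neq => ->.
  by rewrite powR0// gt_eqF//; lra.
have iso' A : ((#|` A|%:R `^ a^-1)%:E <= K%:E * variation S (ind R A))%E.
  by rewrite invrK.
have := variation_powR_le ga0 gaal al1 e0 v0.
have := gradient_sobolev a1 (ltW K0) iso' w0 wfin.
rewrite mE v1 mule1.
under eq_total do rewrite -powRrM ala.
rewrite v1 -/M -/d.
move: hv; have : (0 <= total (fun x => h x `^ p)%R)%E.
  by apply: total_ge0 => x; exact: powR_ge0.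
case: (total (fun x => h x `^ p)%R) => [H| |]//; last by move=> *; rewrite leey.
rewrite -EFinM -EFinD => H0 hv sob var en.
have two0 : (0 <= 2%:E :> \bar R)%E by rewrite lee_fin.
have {}en := le_trans en (lee_wpmul2l two0 hv).
have Me0 : (0 <= (M / e)%:E)%E by rewrite lee_fin divr_ge0// ltW.
have := le_trans var (leeD2r _ (lee_wpmul2l Me0 en)).
rewrite -!EFinM -EFinD.
move: sob (variation_ge0 S (fun x => v x `^ al)).
case: (variation S _) => [r| |]// /(_ _ erefl).
rewrite !lee_fin => Kra r0 {var en hv two0 Me0}.
set D := dl `^ (1 - p) => rle.
have Kr : 1 <= K * r.
  rewrite leNgt; apply: contraTN Kra => Kr1; rewrite -ltNge.
  have <- : 1 `^ a = 1 :> R by rewrite powR1.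
  apply: gt0_ltr_powR; rewrite ?nnegrE//; first by lra.
  by rewrite mulr_ge0// ltW.
have Ked : K * (e * (2 * d)) <= 1 / 4.
  rewrite (_ : K * _ = 1 / 4 * (d / (d + 1))); last first.
    by rewrite /e; field; rewrite !gt_eqF//; lra.
  have : d / (d + 1) <= 1 by rewrite ler_pdivrMr; lra.
  lra.
have Kdl : K * (M / e * (2 * dl)) = 1 / 4.
  by rewrite /dl; field; rewrite !gt_eqF.
have KDH : K * (M / e * (2 * (D * H))) = B * H / 2.
  by rewrite /B -/D; field; rewrite gt_eqF.
have := ler_wpM2l (ltW K0) rle; rewrite !mulrDr Kdl KDH => BH.
rewrite -[B^-1]mulr1 ler_pdivrMl//; lra.
Qed.
End Sobolev.

Definition vanishes_at_infinity (R : realType) (T : choiceType) (u : T -> R) :=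
  forall e : R, 0 < e -> finite_set [set x | e < `|u x|].

Section Sobolev2.
Variables (R : realType) (G : groupType) (S : set G).
Hypotheses (S_finite : finite_set S) (S_gen : generates S)
  (S_sym : symmetric_set S).
Variables (N : nat) (p : R).
Hypotheses (N_ge2 : (2 <= N)%N) (G_growth : polynomial_growth R S N)
  (p_gt1 : 1 < p) (p_lt : p < N%:R / 2).
Implicit Types (u v h f : G -> R).

Let q : R := N%:R * p / (N%:R - 2 * p).
Let q_gt0 : 0 < q := critical_exponent_gt0 N_ge2 p_gt1 p_lt.
Let p_gt0 : 0 < p := lt_trans ltr01 p_gt1.

(** [sobolev_normalized] applied to v and h divided by the q-norm of v. *)
Lemma sobolev_subsolution : exists2 C : R, 0 < C & forall v h (H : R),
  (forall x, 0 <= v x) -> (forall x, 0 <= h x) -> finitely_supported v ->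
  subsolution S v h -> (total (fun x => h x `^ p)%R <= H%:E)%E ->
  (total (fun x => v x `^ q)%R <= (C * H `^ (q / p))%:E)%E.
Proof.
have [c c0 cP] :=
  sobolev_normalized S_finite S_gen S_sym N_ge2 G_growth p_gt1 p_lt.
exists (c^-1 `^ (q / p)); first by rewrite powR_gt0 ?invr_gt0.
move=> v h H v0 h0 vfin vh hH.
have [Q Q0 QE] : exists2 Q : R, 0 <= Q & total (fun x => v x `^ q) = Q%:E.
  apply: total_fin => [x|]; first exact: powR_ge0.
  apply: sub_finite_set vfin => x /=; apply: contra_neq => ->.
  by rewrite powR0 ?gt_eqF.
rewrite QE lee_fin; move: Q0; rewrite le_eqVlt => /predU1P[<-|Q0].
  by rewrite mulr_ge0 ?powR_ge0.
pose t := Q `^ q^-1; have t0 : 0 < t by rewrite powR_gt0.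
have ti0 : 0 <= t^-1 by rewrite invr_ge0 ltW.
have tq : t `^ q = Q by rewrite powRVK ?gt_eqF// ltW.
have pV r : t^-1 `^ r = (t `^ r)^-1.
  by rewrite -[t^-1]powR_inv1 ?(ltW t0)// powRAC powR_inv1// powR_ge0.
have := cP (fun x => t^-1 * v x) (fun x => t^-1 * h x).
have -> : total (fun x => (t^-1 * v x) `^ q) = 1%E.
  under eq_total do rewrite powRM// pV.
  rewrite totalZ ?invr_ge0 ?powR_ge0// => [|x]; last exact: powR_ge0.
  by rewrite QE tq -EFinM mulVf// gt_eqF.
have -> : total (fun x => (t^-1 * h x) `^ p) =
    ((t `^ p)^-1%:E * total (fun x => h x `^ p)%R)%E.
  under eq_total do rewrite powRM// pV.
  by rewrite totalZ ?invr_ge0 ?powR_ge0// => x; exact: powR_ge0.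
have tp0 : 0 < t `^ p by exact: powR_gt0.
move=> /(_ _ _ _ _ erefl) ctH.
have : (c%:E <= ((t `^ p)^-1)%:E * H%:E)%E.
  apply: le_trans (ctH _ _ _ _) _.
  - by move=> x; exact: mulr_ge0.
  - by move=> x; exact: mulr_ge0.
  - by apply: sub_finite_set vfin => x /=; apply: contra_neq => ->; rewrite mulr0.
  - move=> x; rewrite mulrCA -mulr_sumr -mulrDr ler_wpM2l//; exact: vh.
  - by rewrite lee_wpmul2l// lee_fin invr_ge0 ltW.
rewrite -EFinM lee_fin ler_pdivlMl// => ctpH.
have H0 : 0 <= H by apply: le_trans ctpH; rewrite mulr_ge0// ltW.
rewrite -powRM ?invr_ge0 ?(ltW c0)//.
have -> : Q = (t `^ p) `^ (q / p).
  by rewrite -powRrM mulrCA divff ?mulr1// gt_eqF.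
apply: ler_powR2; rewrite ?powR_ge0//.
  by rewrite divr_ge0// ltW.
by rewrite mulrC ler_pdivlMr.
Qed.

(** Kato's inequality for the truncation: where |u| > e, lowering the
    neighbours' values by e is compensated by the same shift at x, and
    elsewhere the left-hand side is 0. *)
Lemma laplacian_norm_subsolution u (e : R) : 0 <= e ->
  subsolution S (fun x => Num.max (`|u x| - e) 0) (fun x => `|laplacian S u x|).
Proof.
move=> e0 x; set sS := fset_set S; set d : R := #|` sS|%:R.
have [ue|ue] := leP (`|u x| - e) 0.
  rewrite mulr0 addr_ge0// sumr_ge0// => s _.
  by rewrite le_max lexx orbT.
have -> : d * (`|u x| - e) = `|d * u x| - d * e by rewrite mulrBr normrM normr_nat.
have dE : d * e = \sum_(s <- sS) e.
  by rewrite big_const_seq iter_addr_0 count_predT mulr_natl.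
have -> : d * u x = \sum_(s <- sS) u (x * s)%g - laplacian S u x.
  by rewrite laplacianEcard// opprB addrC subrK.
apply: (@le_trans _ _ (\sum_(s <- sS) `|u (x * s)%g| + `|laplacian S u x| - d * e)).
  by rewrite lerD2r (le_trans (ler_normB _ _))// lerD2r ler_norm_sum.
rewrite addrAC lerD2r dE -sumrB; apply: ler_sum => s _.
by rewrite le_max lexx.
Qed.

(** The second-order Sobolev inequality. Stating it for functions tending to 0
    at infinity, and not only for finitely supported ones, is what lets it
    apply to u - phi_k for any u in l^q; in particular it contains the
    uniqueness of such u given its Laplacian. *)
Lemma sobolev_vanishing : exists2 C : R, 0 < C & forall u (H : R),
  vanishes_at_infinity u ->
  (total (fun x => `|laplacian S u x| `^ p)%R <= H%:E)%E ->
  (total (fun x => `|u x| `^ q)%R <= (C * H `^ (q / p))%:E)%E.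
Proof.
have [C C0 CP] := sobolev_subsolution.
exists (2 `^ q * C); first by rewrite mulr_gt0 ?powR_gt0.
move=> u H u0 uH; apply: total_lub => F.
(* At such a level e, the truncation is at least |u| / 2 all over F; the
   factor 2^q avoids a passage to the limit in e. *)
have [e e0 eF] : exists2 e : R, 0 < e &
    {in F, forall x, u x != 0 -> 2 * e <= `|u x|}.
  have [F0|F0] := eqVneq [seq x <- enum_fset F | u x != 0] [::].
    exists 1 => // x xF ux; have : x \in [seq x <- enum_fset F | u x != 0].
      by rewrite mem_filter ux.
    by rewrite F0.
  have [x] := seq_argmin (fun x => `|u x|) F0.
  rewrite mem_filter => /andP[ux xF] xmin; exists (`|u x| / 2).
    by rewrite divr_gt0// normr_gt0.
  move=> y yF uy; rewrite mulrC divfK// xmin//.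
  by rewrite mem_filter uy.
pose v x := Num.max (`|u x| - e) 0.
have v0 x : 0 <= v x by rewrite le_max lexx orbT.
have vfin : finitely_supported v.
  apply: sub_finite_set (u0 _ e0) => x /=; apply: contraNT; rewrite -leNgt => ue.
  by rewrite /v; apply/eqP/max_idPr; rewrite subr_le0.
have := CP v _ H v0 (fun x => normr_ge0 _) vfin
  (laplacian_norm_subsolution u (ltW e0)) uH.
have vq x : 0 <= v x `^ q by exact: powR_ge0.
move=> /(le_trans (sum_le_total F vq)); rewrite !lee_fin => vF.
rewrite -mulrA; apply: le_trans (ler_wpM2l (powR_ge0 _ _) vF).
rewrite mulr_sumr big_seq [leRHS]big_seq; apply: ler_sum => x xF.
rewrite -powRM//; apply: ler_powR2 => //; first exact: ltW.
have [->|ux] := eqVneq (u x) 0; first by rewrite normr0 mulr_ge0.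
have := eF _ xF ux; have : `|u x| - e <= v x by rewrite le_max lexx.
lra.
Qed.

End Sobolev2.

(** * Density of the Laplacians of finitely supported functions *)

Section FinitelySupported.
Variables (R : realType) (T : choiceType).
Implicit Types (u v : T -> R).

Lemma finitely_supportedD u v : finitely_supported u -> finitely_supported v ->
  finitely_supported (fun x => u x + v x).
Proof.
move=> uf vf; have : finite_set ([set x | u x != 0] `|` [set x | v x != 0]).
  by rewrite finite_setU.
apply: sub_finite_set => x /= uv; have [u0|] := eqVneq (u x) 0; last by left.
by right; move: uv; rewrite u0 add0r.
Qed.

Lemma finitely_supportedZ (c : R) u : finitely_supported u ->
  finitely_supported (fun x => c * u x).
Proof.
by apply: sub_finite_set => x /=; apply: contra_neq => ->; rewrite mulr0.
Qed.

Lemma finitely_supported_sum (I : Type) (r : seq I) (u : I -> T -> R) :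
  (forall i, finitely_supported (u i)) ->
  finitely_supported (fun x => \sum_(i <- r) u i x).
Proof.
move=> uf; elim: r => [|i r IH].
  by apply: sub_finite_set (finite_set0 T) => x /=; rewrite big_nil eqxx.
under eq_fun do rewrite big_cons.
exact: finitely_supportedD.
Qed.

End FinitelySupported.

Lemma finitely_supported_shift (R : realType) (G : groupType) (u : G -> R) g :
  finitely_supported u -> finitely_supported (fun x => u (x * g)%g).
Proof.
move=> uf; apply: sub_finite_set (finite_image (fun x => x * g^-1)%g uf) => x /= ux.
by exists (x * g)%g => //; rewrite mulgK.
Qed.

Lemma laplacian_fin (R : realType) (G : groupType) (S : set G) (u : G -> R) :
  finite_set S -> finitely_supported u -> finitely_supported (laplacian S u).
Proof.
move=> Sfin uf; rewrite (_ : laplacian S u = fun x =>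
    \sum_(s <- fset_set S) u (x * s)%g + - #|` fset_set S|%:R * u x); last first.
  by apply/funext => x; rewrite laplacianEcard// mulNr.
apply: finitely_supportedD; last exact: finitely_supportedZ.
by apply: finitely_supported_sum => s; exact: finitely_supported_shift.
Qed.

Section Average.
Variables (R : realType) (G : groupType) (S : set G).
Hypothesis S_finite : finite_set S.
Hypothesis S_card : (0 < #|` fset_set S|)%N.
Implicit Types (u v f : G -> R).

Let d : R := #|` fset_set S|%:R.
Let d_gt0 : 0 < d. Proof. by rewrite ltr0n. Qed.

Definition average u x : R := d^-1 * \sum_(s <- fset_set S) u (x * s)%g.

Lemma laplacian_average u x : laplacian S u x = d * (average u x - u x).
Proof.
by rewrite laplacianEcard// /average mulrBr mulVKf ?gt_eqF.
Qed.

Lemma average_ge0 u : (forall x, 0 <= u x) -> forall x, 0 <= average u x.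
Proof. by move=> u0 x; rewrite mulr_ge0 ?invr_ge0 ?(ltW d_gt0)// sumr_ge0. Qed.

Lemma average_fin u : finitely_supported u -> finitely_supported (average u).
Proof.
move=> uf; apply/finitely_supportedZ/finitely_supported_sum => s.
exact: finitely_supported_shift.
Qed.

Lemma total_average u : (forall x, 0 <= u x) -> total (average u) = total u.
Proof.
move=> u0; rewrite totalZ ?invr_ge0 ?(ltW d_gt0)//; last first.
  by move=> x; rewrite sumr_ge0.
rewrite total_sum//; under eq_bigr do rewrite total_shift.
rewrite sume_const_seq ?total_ge0// muleA -EFinM mulVf ?mul1e//.
by rewrite gt_eqF.
Qed.

Lemma average_sum (I : Type) (r : seq I) (u : I -> G -> R) x :
  average (fun y => \sum_(i <- r) u i y) x = \sum_(i <- r) average (u i) x.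
Proof. by rewrite /average exchange_big/= mulr_sumr. Qed.

Lemma averageZ (c : R) u x : average (fun y => c * u y) x = c * average u x.
Proof. by rewrite /average -mulr_sumr mulrCA. Qed.

Lemma average_norm_le u v : (forall x, `|u x| <= v x) ->
  forall x, `|average u x| <= average v x.
Proof.
move=> uv x; rewrite normrM ger0_norm ?invr_ge0 ?(ltW d_gt0)//.
rewrite ler_wpM2l ?invr_ge0 ?(ltW d_gt0)// (le_trans (ler_norm_sum _ _ _))//.
exact: ler_sum.
Qed.

Definition walk k f : G -> R := iter k average f.

Lemma walk_ge0 k f : (forall x, 0 <= f x) -> forall x, 0 <= walk k f x.
Proof. by move=> f0; elim: k => // k IH; exact: average_ge0. Qed.

Lemma walk_fin k f : finitely_supported f -> finitely_supported (walk k f).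
Proof. by move=> ff; elim: k => // k IH; exact: average_fin. Qed.

Lemma total_walk k f : (forall x, 0 <= f x) -> total (walk k f) = total f.
Proof.
by move=> f0; elim: k => // k IH; rewrite [LHS]total_average//; exact: walk_ge0.
Qed.

Lemma walk_norm_le k f x : `|walk k f x| <= walk k (fun y => `|f y|) x.
Proof. by elim: k x => // k IH x; exact: average_norm_le. Qed.

(** The Green function of the walk stopped at time n, applied to f. *)
Definition green n f x : R := \sum_(0 <= k < n) walk k f x.

Lemma green_fin n f : finitely_supported f -> finitely_supported (green n f).
Proof. by move=> ff; apply: finitely_supported_sum => k; exact: walk_fin. Qed.

Lemma green_ge0 n f : (forall x, 0 <= f x) -> forall x, 0 <= green n f x.
Proof. by move=> f0 x; rewrite sumr_ge0// => k _; exact: walk_ge0. Qed.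

Lemma total_green n f : (forall x, 0 <= f x) ->
  total (green n f) = (n%:R%:E * total f)%E.
Proof.
move=> f0; rewrite /green total_sum; last by move=> k; exact: walk_ge0.
under eq_bigr do rewrite total_walk//.
by rewrite sume_const_seq ?total_ge0// size_iota subn0.
Qed.

Lemma average_green n f x :
  average (green n f) x = green n f x - f x + walk n f x.
Proof.
rewrite [LHS]average_sum /green.
have -> : \sum_(0 <= k < n) walk k f x =
          \sum_(0 <= k < n.+1) walk k f x - walk n f x.
  by rewrite big_nat_recr//= addrK.
rewrite big_nat_recl// (_ : walk 0 f x = f x)//.
by rewrite [LHS](_ : _ = \sum_(0 <= k < n) walk k.+1 f x)//; ring.
Qed.

(** Telescoping: d (1 - P) applied to the sum is d (f - P^n f). The right-hand
    side does not depend on n, so neither does the resulting Sobolev bound. *)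
Lemma green_subsolution n f : (forall x, 0 <= f x) ->
  subsolution S (green n f) (fun x => d * f x).
Proof.
move=> f0 x; have := average_green n f x; rewrite /average => /(canRL (mulKf _)).
rewrite invr_eq0 gt_eqF// invrK => /(_ isT) ->.
rewrite -/d -mulrDr ler_wpM2l ?(ltW d_gt0)//.
have := walk_ge0 n f0 x; lra.
Qed.

(** The formal solution of Delta phi = f, that is - (1/d) sum_k P^k f, replaced
    by the Cesaro means of its partial sums, which are finitely supported. *)
Definition cesaro_potential n f x : R :=
  - (d^-1 / n%:R) * \sum_(0 <= j < n) green j f x.

Lemma laplacian_cesaro_potential n f x : (0 < n)%N ->
  laplacian S (cesaro_potential n f) x = f x - green n f x / n%:R.
Proof.
move=> n0; have nn : n%:R != 0 :> R by rewrite pnatr_eq0 -lt0n.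
rewrite laplacian_average averageZ average_sum /cesaro_potential.
under eq_bigr do rewrite average_green.
rewrite big_split/= sumrB -/(green n f x) sumr_const_nat subn0 -mulr_natl.
by field; rewrite nn gt_eqF.
Qed.

Lemma cesaro_potential_fin n f : finitely_supported f ->
  finitely_supported (cesaro_potential n f).
Proof.
by move=> ff; apply/finitely_supportedZ/finitely_supported_sum => j; exact: green_fin.
Qed.

End Average.

Section Density.
Variables (R : realType) (G : groupType) (S : set G).
Hypotheses (S_finite : finite_set S) (S_gen : generates S)
  (S_sym : symmetric_set S).
Variables (N : nat) (p : R).
Hypotheses (N_ge2 : (2 <= N)%N) (G_growth : polynomial_growth R S N)
  (p_gt1 : 1 < p) (p_lt : p < N%:R / 2).
Implicit Types (u v h f : G -> R).

Let q : R := N%:R * p / (N%:R - 2 * p).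
Let q_gt0 : 0 < q := critical_exponent_gt0 N_ge2 p_gt1 p_lt.
Let p_gt0 : 0 < p := lt_trans ltr01 p_gt1.

(** With no generator, the indicator of a point would be a subsolution for
    h = 0, against the Sobolev inequality. *)
Lemma card_steps_gt0 : (0 < #|` fset_set S|)%N.
Proof.
have [c c0 cP] :=
  sobolev_normalized S_finite S_gen S_sym N_ge2 G_growth p_gt1 p_lt.
rewrite lt0n; apply/eqP => S0.
have : (c%:E <= total (fun _ : G => (0 : R) `^ p)%R)%E.
  apply: (cP (ind R [fset 1%g]%fset) (fun=> 0)) => //.
  - apply: (@fset_finitely_supported _ _ _ [fset 1%g]%fset) => x.
    by rewrite /ind => /negPf ->.
  - by move=> x; rewrite S0 mul0r addr0 sumr_ge0.
  - rewrite (@eq_total _ _ _ (ind R [fset 1%g]%fset)) ?total_ind ?cardfs1// => x.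
    by rewrite /ind; case: (_ \in _); rewrite ?powR1// powR0 ?gt_eqF.
under eq_total do rewrite powR0 ?gt_eqF//.
by rewrite total0 lee_fin leNgt c0.
Qed.

(** The error is the Cesaro mean of P^k f. It is bounded by B / n, where B
    comes from the Sobolev inequality, and its l^1 norm is at most that of f;
    hence its p-th power sums to at most (B / n)^(p - 1) times the l^1 norm. *)
Lemma density_finite f (e : R) : finitely_supported f -> 0 < e ->
  exists2 phi : G -> R, finitely_supported phi &
    (total (fun x => `|laplacian S phi x - f x| `^ p)%R <= e%:E)%E.
Proof.
move=> ff e0; have S0 := card_steps_gt0.
have [C C0 CP] :=
  sobolev_subsolution S_finite S_gen S_sym N_ge2 G_growth p_gt1 p_lt.
set d : R := #|` fset_set S|%:R; pose g x := `|f x|.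
have gf : finitely_supported g.
  by apply: sub_finite_set ff => x /=; rewrite normr_eq0.
have g0 x : 0 <= g x by exact: normr_ge0.
have [H H0 HE] : exists2 H : R, 0 <= H & total (fun x => (d * g x) `^ p) = H%:E.
  apply: total_fin => [x|]; first exact: powR_ge0.
  apply: sub_finite_set gf => x /=; apply: contra_neq => ->.
  by rewrite mulr0 powR0// gt_eqF.
have [F F0 FE] := total_fin g0 gf.
pose B := (C * H `^ (q / p)) `^ q^-1.
have gB n x : green S n g x <= B.
  have : (total (fun x => green S n g x `^ q)%R <= (C * H `^ (q / p))%:E)%E.
    apply: CP (fun x => d * g x) _ _ _ _ _ _.
    - by apply: green_ge0.
    - by move=> y; rewrite mulr_ge0.
    - exact: green_fin.
    - exact: green_subsolution.
    - by rewrite HE.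
  have gq y : 0 <= green S n g y `^ q by exact: powR_ge0.
  move=> /(le_trans (le_total1 x gq)); rewrite lee_fin => H1.
  rewrite -[leLHS](@powRKV _ _ q) ?gt_eqF ?green_ge0//.
  by apply: ler_powR2; rewrite ?powR_ge0// invr_ge0 ltW.
have B0 : 0 <= B by exact: powR_ge0.
(* F + 1 instead of F, so that f = 0 needs no separate treatment. *)
pose eta := (e / (F + 1)) `^ (p - 1)^-1.
have eF : 0 < e / (F + 1) by rewrite divr_gt0//; lra.
have eta0 : 0 < eta by rewrite powR_gt0.
pose n := (Num.truncn (B / eta)).+1.
have n0 : 0 < n%:R :> R by rewrite ltr0n.
have nB : B / n%:R <= eta.
  rewrite ler_pdivrMr// mulrC -ler_pdivrMr// ltW//; exact: truncnS_gt.
exists (cesaro_potential S n f); first exact: cesaro_potential_fin.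
have p1 : 0 < p - 1 by move: p_gt1; lra.
apply: (@le_trans _ _
    (total (fun x => eta `^ (p - 1) * (n%:R^-1 * green S n g x))%R)).
  apply: le_total => x; rewrite laplacian_cesaro_potential//.
  rewrite addrAC subrr add0r normrN normrM normfV normr_nat mulrC.
  have gx : `|green S n f x| <= green S n g x.
    rewrite (le_trans (ler_norm_sum _ _ _))//; apply: ler_sum => k _.
    exact: walk_norm_le.
  have gx0 : 0 <= n%:R^-1 * green S n g x.
    by rewrite mulr_ge0 ?invr_ge0 ?(ltW n0)// (le_trans _ gx).
  apply: (@le_trans _ _ ((n%:R^-1 * green S n g x) `^ p)).
    apply: ler_powR2; first exact: ltW.
      by rewrite mulr_ge0 ?invr_ge0 ?(ltW n0).
    by rewrite ler_wpM2l ?invr_ge0 ?(ltW n0).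
  rewrite -mulr_powRB1// mulrC ler_wpM2r//.
  apply: ler_powR2 => //; first exact: ltW.
  apply: le_trans nB; rewrite mulrC ler_wpM2r ?invr_ge0 ?(ltW n0)//.
have gg0 x : 0 <= n%:R^-1 * green S n g x.
  by rewrite mulr_ge0 ?invr_ge0 ?(ltW n0)// green_ge0.
rewrite totalZ ?powR_ge0// totalZ ?invr_ge0 ?(ltW n0)//; last exact: green_ge0.
rewrite total_green// FE -!EFinM lee_fin mulKf ?gt_eqF//.
rewrite powRVK ?gt_eqF ?(ltW eF)// mulrAC ler_pdivrMr; last by lra.
by rewrite ler_wpM2l ?(ltW e0)//; lra.
Qed.

Lemma total_normD_le f h :
  (total (fun x => `|f x + h x| `^ p)%R <=
   (2 `^ p)%:E *
   (total (fun x => `|f x| `^ p)%R + total (fun x => `|h x| `^ p)%R))%E.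
Proof.
rewrite -totalD; [|by move=> x; exact: powR_ge0..].
rewrite -totalZ ?powR_ge0//.
by apply: le_total => x; apply: powR_normD_le; exact: ltW.
Qed.

Lemma density f (e : R) : (total (fun x => `|f x| `^ p)%R < +oo)%E -> 0 < e ->
  exists2 phi : G -> R, finitely_supported phi &
    (total (fun x => `|laplacian S phi x - f x| `^ p)%R <= e%:E)%E.
Proof.
move=> fp e0; pose e' := e / (2 `^ p * 2).
have e'0 : 0 < e' by rewrite divr_gt0// mulr_gt0// powR_gt0.
have [F FP] := total_tail (fun x => powR_ge0 `|f x| p) fp e'0.
pose fF x := if x \in F then f x else 0.
have fFfin : finitely_supported fF.
  by apply: (@fset_finitely_supported _ _ _ F) => x /negPf; rewrite /fF => ->.
have [phi phif phiP] := density_finite fFfin e'0.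
exists phi => //.
rewrite (_ : (fun x => _) =
    fun x => `|(laplacian S phi x - fF x) + (fF x - f x)| `^ p).
  apply: le_trans (total_normD_le _ _) _.
  have -> : e%:E = ((2 `^ p)%:E * (e'%:E + e'%:E))%E.
    rewrite -EFinD -EFinM; congr EFin; rewrite /e'; field.
    by rewrite gt_eqF// powR_gt0.
  rewrite lee_wpmul2l ?lee_fin ?powR_ge0// leeD//.
  apply: le_trans FP; apply: le_total => x; rewrite /fF; case: ifP => _.
    by rewrite subrr normr0 powR0// gt_eqF.
  by rewrite sub0r normrN.
by apply/funext => x; rewrite addrA subrK.
Qed.

End Density.

(** * Limits in l^p *)

Section LpNorm.
Variables (R : realType) (T : choiceType) (p : R).
Hypothesis p_gt0 : 0 < p.
Implicit Types u : T -> R.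

Let ptotal u := total (fun x => `|u x| `^ p).

Lemma ptotal_ge0 u : (0 <= ptotal u)%E.
Proof. by apply: total_ge0 => x; exact: powR_ge0. Qed.

Lemma lp_norm_ltP u (e : R) : 0 < e ->
  (lp_norm p u < e%:E)%E <-> (total (fun x => `|u x| `^ p)%R < (e `^ p)%:E)%E.
Proof.
move=> e0; rewrite /lp_norm -/(total (fun x => `|u x| `^ p)) -/(ptotal u).
have pi0 : 0 < p^-1 by rewrite invr_gt0.
move: (ptotal_ge0 u); case: (ptotal u) => [r| |]//; last first.
  by rewrite poweRyr ?gt_eqF.
rewrite poweR_EFin !lte_fin lee_fin => r0.
split=> H.
  rewrite -[X in X < _](@powRVK _ r p) ?gt_eqF//.
  by apply: gt0_ltr_powR; rewrite ?nnegrE ?powR_ge0// ltW.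
rewrite -[X in _ < X](@powRKV _ e p) ?(ltW e0) ?gt_eqF//.
by apply: gt0_ltr_powR; rewrite ?nnegrE ?powR_ge0.
Qed.

Lemma lp_norm_ltyP u :
  (lp_norm p u < +oo)%E <-> (total (fun x => `|u x| `^ p)%R < +oo)%E.
Proof.
rewrite /lp_norm -/(total (fun x => `|u x| `^ p)) -/(ptotal u).
have pi0 : 0 < p^-1 by rewrite invr_gt0.
move: (ptotal_ge0 u); case: (ptotal u) => [r| |]//; last by rewrite poweRyr ?gt_eqF.
by rewrite poweR_EFin !ltry.
Qed.

(** A weak form of Fatou's lemma, enough for finiteness: the constant 2^p saves
    the continuity of the power function. *)
Lemma total_limit_le (phi : nat -> T -> R) u (B : R) (k0 : nat) :
    (forall x, phi k x @[k --> \oo] --> u x) ->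
    (forall k, (k0 <= k)%N -> (total (fun x => `|phi k x| `^ p)%R <= B%:E)%E) ->
  (total (fun x => `|u x| `^ p)%R <= (2 `^ p * (B + 1))%:E)%E.
Proof.
move=> phiu phiB; apply: total_lub => F; rewrite lee_fin.
pose m : R := #|` F|%:R; have m0 : 0 <= m by [].
pose e := (m + 1)^-1 `^ p^-1.
have e0 : 0 < e by rewrite powR_gt0// invr_gt0; lra.
have [k kk0 kF] : exists2 k, (k0 <= k)%N & {in F, forall x, `|u x - phi k x| <= e}.
  have : \forall k \near \oo, {in enum_fset F, forall x, `|u x - phi k x| <= e}.
    elim: (enum_fset F) => [|x r IH]; first by near=> k.
    have /cvgrPdist_le/(_ _ e0) H := phiu x; near=> k => y.
    rewrite in_cons => /predU1P[->|yr]; first by near: k.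
    have : {in r, forall x, `|u x - phi k x| <= e} by near: k.
    exact.
  move=> [k1 _ H]; exists (maxn k0 k1); first exact: leq_maxl.
  by apply: H; rewrite /= leq_maxr.
have ep : m * e `^ p <= 1.
  rewrite powRVK ?gt_eqF ?invr_ge0//; last by lra.
  by rewrite ler_pdivrMr; lra.
apply: (@le_trans _ _ (\sum_(x <- F) 2 `^ p * (`|phi k x| `^ p + e `^ p))).
  rewrite big_seq [leRHS]big_seq; apply: ler_sum => x xF.
  rewrite -[X in `|X| `^ _ <= _](subrKC (phi k x)).
  apply: le_trans (powR_normD_le _ _ (ltW p_gt0)) _.
  rewrite ler_wpM2l ?powR_ge0// lerD2l ler_powR2 ?(ltW p_gt0)//.
  exact: kF.
rewrite -mulr_sumr ler_wpM2l ?powR_ge0// big_split/= lerD//.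
  rewrite -lee_fin; apply: le_trans (phiB _ kk0).
  by apply: sum_le_total => x; exact: powR_ge0.
by rewrite big_const_seq iter_addr_0 count_predT -mulr_natl.
Unshelve. all: by end_near.
Qed.

Lemma summable_vanishes u :
  (total (fun x => `|u x| `^ p)%R < +oo)%E -> vanishes_at_infinity u.
Proof.
move=> up e e0; have ep0 : 0 < e `^ p by rewrite powR_gt0.
apply: sub_finite_set (total_vanish (fun x => powR_ge0 `|u x| p) up ep0) => x /= eu.
by apply: gt0_ltr_powR; rewrite ?nnegrE// ltW.
Qed.

Lemma finitely_supported_vanishes u :
  finitely_supported u -> vanishes_at_infinity u.
Proof.
move=> uf e e0; apply: sub_finite_set uf => x /= eu.
by rewrite -normr_gt0 (lt_trans e0).
Qed.

Lemma vanishesB u v : vanishes_at_infinity u -> vanishes_at_infinity v ->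
  vanishes_at_infinity (fun x => u x - v x).
Proof.
move=> uz vz e e0; have e20 : 0 < e / 2 by rewrite divr_gt0.
have : finite_set ([set x | e / 2 < `|u x|] `|` [set x | e / 2 < `|v x|]).
  by rewrite finite_setU; split; [exact: uz|exact: vz].
apply: sub_finite_set => x /= euv.
have [|ue] := ltP (e / 2) `|u x|; first by left.
right; have := le_lt_trans ue (_ : e / 2 < _); have := ler_normB (u x) (v x).
lra.
Qed.

End LpNorm.

Theorem theorem12 (R : realType) (G : groupType) (S : set G)
    (S_finite : finite_set S) (S_gen : generates S) (S_sym : symmetric_set S)
    (N : nat) (N_ge3 : (3 <= N)%N) (G_growth : polynomial_growth R S N)
    (p : R) (p_gt1 : 1 < p) (p_lt : p < N%:R / 2) :
  D2p0_space S p = D2p_space S N p.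
Proof.
have N_ge2 : (2 <= N)%N by exact: ltnW.
have p0 : 0 < p := lt_trans ltr01 p_gt1.
have q0 := critical_exponent_gt0 N_ge2 p_gt1 p_lt.
have [C C0 CP] := sobolev_vanishing S_finite S_gen S_sym N_ge2 G_growth p_gt1 p_lt.
rewrite /D2p0_space /D2p_space /lp_space; set q := _ / (_ - _) in q0 CP *.
have lapB u v : laplacian S (fun x => u x - v x) =
                (fun x => laplacian S u x - laplacian S v x).
  apply/funext => x; rewrite !laplacianEcard// sumrB; ring.
apply/seteqP; split=> u /=.
  move=> [phi [phif phiC phiu]].
  have [K KP] := phiC 1 ltr01.
  pose L k x := laplacian S (phi k) x.
  have LK k : (K <= k)%N -> (total (fun x => `|L k x - L K x| `^ p)%R <= 1%:E)%E.
    move=> kK; have := KP _ _ kK (leqnn K); rewrite /D2p_norm lapB.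
    by move=> /(lp_norm_ltP p0 _ ltr01); rewrite powR1 => /ltW.
  have Lfin k : finitely_supported (L k) by exact: laplacian_fin.
  have [B0 B00 B0E] : exists2 B : R, 0 <= B & total (fun x => `|L K x| `^ p) = B%:E.
    apply: total_fin => [x|]; first exact: powR_ge0.
    apply: sub_finite_set (Lfin K) => x /=; apply: contra_neq => ->.
    by rewrite normr0 powR0// gt_eqF.
  pose B := 2 `^ p * (1 + B0).
  (* From K on, Delta phi_k stays within distance 1 of Delta phi_K. *)
  have LB k : (K <= k)%N -> (total (fun x => `|L k x| `^ p)%R <= B%:E)%E.
    move=> kK; rewrite (_ : (fun x => _) =
        fun x => `|(L k x - L K x) + L K x| `^ p); last first.
      by apply/funext => x; rewrite subrK.
    apply: le_trans (total_normD_le p_gt1 _ _) _.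
    by rewrite B0E /B EFinM EFinD lee_wpmul2l ?lee_fin ?powR_ge0// leeD2r// LK.
  split.
    apply/(lp_norm_ltyP q0); apply: le_lt_trans (ltry _).
    apply: (total_limit_le q0 phiu) => k kK.
    by apply: CP (LB _ kK); exact/finitely_supported_vanishes.
  apply/(lp_norm_ltyP p0); apply: le_lt_trans (ltry _).
  apply: (total_limit_le p0 _ LB) => x.
  rewrite /L laplacianEcard//.
  under eq_fun do rewrite laplacianEcard//.
  apply: cvgB; last exact: cvgMl_tmp.
  apply: cvg_big => [|s _]; [exact: add_continuous|exact: phiu].
move=> [/(lp_norm_ltyP q0) uq /(lp_norm_ltyP p0) up].
have approx k : exists psi : G -> R, finitely_supported psi /\
    (total (fun x => `|laplacian S psi x - laplacian S u x| `^ p)%R <=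
     (k.+1%:R^-1 `^ p)%:E)%E.
  have k0 : 0 < k.+1%:R^-1 `^ p :> R by rewrite powR_gt0.
  have [psi psif psiP] :=
    density S_finite S_gen S_sym N_ge2 G_growth p_gt1 p_lt up k0.
  by exists psi.
have [phi phiP] := choice approx.
exists phi; split=> [k|e e0|x]; first by have [] := phiP k.
(* The constant 4 comes from 2^p * 2 <= 4^p: the left-hand side is the loss in
   adding the errors of phi m and phi n. *)
- pose K := (Num.truncn (4 / e)).+1; exists K => m n Km Kn.
  have inv_le k : (K <= k)%N -> k.+1%:R^-1 <= K%:R^-1 :> R.
    by move=> Kk; rewrite lef_pV2 ?posrE ?ltr0n// ler_nat ltnW.
  apply/(lp_norm_ltP p0 _ e0); rewrite lapB.
  rewrite (_ : (fun x => _) = fun x =>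
      `|(laplacian S (phi m) x - laplacian S u x) +
        - (laplacian S (phi n) x - laplacian S u x)| `^ p); last first.
    by apply/funext => x; congr (`| _ | `^ _); ring.
  apply: le_lt_trans (total_normD_le p_gt1 _ _) _.
  under [X in (_ + X)%E]eq_total do rewrite normrN.
  have KI0 : 0 <= K%:R^-1 :> R by rewrite invr_ge0.
  have bound k : (K <= k)%N ->
      (total (fun x => `|laplacian S (phi k) x - laplacian S u x| `^ p)%R <=
       (K%:R^-1 `^ p)%:E)%E.
    move=> Kk; have [_ /le_trans] := phiP k; apply.
    by rewrite lee_fin ler_powR2 ?(ltW p0)// inv_le.
  apply: (@le_lt_trans _ _
      ((2 `^ p)%:E * ((K%:R^-1 `^ p)%:E + (K%:R^-1 `^ p)%:E))%E).
    by rewrite lee_wpmul2l ?lee_fin ?powR_ge0// leeD// bound.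
  rewrite -EFinD -EFinM lte_fin.
  apply: (@le_lt_trans _ _ ((4 * K%:R^-1) `^ p)).
    rewrite powRM// (_ : 4 = 2 * 2 :> R); last by ring.
    rewrite powRM// -mulrA ler_wpM2l ?powR_ge0//.
    have two_le : 2 <= 2 `^ p :> R by rewrite le1r_powR ?ler1n// ltW.
    have := ler_wpM2r (powR_ge0 K%:R^-1 p) two_le; lra.
  apply: gt0_ltr_powR; rewrite ?nnegrE ?mulr_ge0 ?(ltW e0)//.
  rewrite ltr_pdivrMr ?ltr0n// mulrC -ltr_pdivrMr//; exact: truncnS_gt.
- apply/cvgrPdist_le => e e0; near=> k.
  have [phif phik] := phiP k.
  have := CP (fun x => u x - phi k x) (k.+1%:R^-1 `^ p).
  have zvan := vanishesB (summable_vanishes q0 uq)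
    (finitely_supported_vanishes phif).
  rewrite lapB => /(_ zvan).
  under eq_total do rewrite distrC.
  move=> /(_ phik); rewrite -powRrM (_ : p * (q / p) = q); last first.
    by rewrite mulrCA divff ?mulr1// gt_eqF.
  have zq y : 0 <= `|u y - phi k y| `^ q by exact: powR_ge0.
  move=> /(le_trans (le_total1 x zq)); rewrite lee_fin.
  rewrite -[X in _ <= X * _](@powRVK _ C q) ?(ltW C0) ?gt_eqF//.
  rewrite -powRM ?powR_ge0 ?invr_ge0// => zk.
  have : `|u x - phi k x| <= C `^ q^-1 * k.+1%:R^-1.
    have Ck0 : 0 <= C `^ q^-1 * k.+1%:R^-1 by rewrite mulr_ge0 ?powR_ge0.
    rewrite -[leLHS](@powRKV _ _ q) ?gt_eqF// -[leRHS](@powRKV _ _ q) ?gt_eqF//.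
    by apply: ler_powR2; rewrite ?powR_ge0// invr_ge0 ltW.
  move=> /le_trans; apply; rewrite ler_pdivrMr ?ltr0n// mulrC -ler_pdivrMr//.
  apply: (@le_trans _ _ (Num.truncn (C `^ q^-1 / e)).+1%:R).
    by rewrite ltW// truncnS_gt.
  rewrite ler_nat ltnS; near: k; exact: nbhs_infty_ge.
Unshelve. all: by end_near.
Qed.
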